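(* Let $G$ be a compact, connected Lie group, $K$ a closed, connected subgroup of $G$, $\widetilde{G}$ a finite central covering of $G$, and $\widetilde{K}_0$ the identity component of the preimage of $K$ in $\widetilde{G}$. Then the pair $(G,K)$ is isotropy-formal if and only if the pair $(\widetilde{G},\widetilde{K}_0)$ is isotropy-formal.
   Context: All cohomology is singular cohomology with rational coefficients. For a topological group $H$ acting continuously on a space $X$, the homotopy quotient (Borel construction) is $X_H = (EH\times X)/\big((eh,x)\sim(e,hx)\big)$, where $EH\to BH$ is a universal principal $H$-bundle; it is the total space of the Borel fibration $X\to X_H\to BH$, and $H^*_H(X)=H^*(X_H;\mathbb{Q})$. The action is equivariantly formal if the fiber inclusion $X\hookrightarrow X_H$ induces a surjection $H^*_H(X)\to H^*(X)$. For a Lie group $G$ and a closed subgroup $K$, the isotropy action is the natural left $K$-action on the space $G/K$ of left cosets; the pair $(G,K)$ is called isotropy-formal if this action is equivariantly formal. A finite central covering of $G$ is a connected Lie group $\widetilde{G}$ with a surjective homomorphism $\widetilde{G}\to G$ whose kernel is finite and central. *)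

(* Defs.v *)
From HB Require Import structures.
From mathcomp Require Import all_boot all_order all_algebra.
From mathcomp Require Import all_classical all_reals all_analysis.

Set Implicit Arguments.
Unset Strict Implicit.
Unset Printing Implicit Defensive.

Import Order.TTheory GRing.Theory Num.Theory.
Import numFieldNormedType.Exports.

Local Open Scope classical_set_scope.
Local Open Scope ring_scope.
Local Open Scope quotient_scope.

HB.mixin Record isTopologicalGroup G & Topological G & Group G := {
  mulg_continuous : continuous (fun z : G * G => (z.1 * z.2)%g);
  invg_continuous : continuous (fun x : G => (x^-1)%g)
}.

#[short(type="topologicalGroupType")]
HB.structure Definition TopologicalGroup :=
  {G of Topological G & Group G & isTopologicalGroup G}.

Lemma lmulg_continuous (G : topologicalGroupType) (g : G) :
  continuous (fun x : G => (g * x)%g).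
Proof.
move=> x; apply: (@continuous_comp _ _ _ (fun x : G => (g, x))
  (fun z : G * G => (z.1 * z.2)%g)); last exact: mulg_continuous.
by apply: cvg_pair => /=; [exact: cvg_cst|exact: cvg_id].
Qed.

Lemma rmulg_continuous (G : topologicalGroupType) (g : G) :
  continuous (fun x : G => (x * g)%g).
Proof.
move=> x; apply: (@continuous_comp _ _ _ (fun x : G => (x, g))
  (fun z : G * G => (z.1 * z.2)%g)); last exact: mulg_continuous.
by apply: cvg_pair => /=; [exact: cvg_id|exact: cvg_cst].
Qed.

Record subgroup (G : groupType) := Subgroup {
  subgroup_set :> set G;
  subgroup1 : subgroup_set 1%g;
  subgroupM : forall x y, subgroup_set x -> subgroup_set y ->
    subgroup_set (x * y)%g;
  subgroupV : forall x, subgroup_set x -> subgroup_set (x^-1)%g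
}.

Section SubgroupTopologicalGroup.
Context (G : topologicalGroupType) (K : subgroup G).

Lemma subgroup_closed_subproof : group_closed (mem (subgroup_set K)).
Proof.
split=> [|x y]; first by apply/mem_set; exact: subgroup1.
move=> /set_mem Kx /set_mem Ky; apply/mem_set; apply: subgroupM => //.
exact: subgroupV.
Qed.

HB.instance Definition _ := SubChoice.copy (set_type (subgroup_set K))
  {x : G | x \in subgroup_set K}.

HB.instance Definition _ := SubChoice_isSubGroup.Build G
  (mem (subgroup_set K)) (set_type (subgroup_set K)) subgroup_closed_subproof.

Lemma subgroup_mulg_continuous :
  continuous (fun z : set_type K * set_type K => (z.1 * z.2)%g : set_type K).
Proof.
apply: continuous_comp_initial => z.
apply: (@continuous_comp _ _ _
  (fun z : set_type K * set_type K => (set_val z.1, set_val z.2))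
  (fun z : G * G => (z.1 * z.2)%g)); last exact: mulg_continuous.
apply: cvg_pair => /=.
  by apply: continuous_comp; [exact: cvg_fst|exact: initial_continuous].
by apply: continuous_comp; [exact: cvg_snd|exact: initial_continuous].
Qed.

Lemma subgroup_invg_continuous :
  continuous (fun x : set_type K => (x^-1)%g : set_type K).
Proof.
apply: continuous_comp_initial => x.
apply: (@continuous_comp _ _ _ (set_val : set_type K -> G)
  (fun x : G => (x^-1)%g)); last exact: invg_continuous.
exact: initial_continuous.
Qed.

HB.instance Definition _ := isTopologicalGroup.Build (set_type K)
  subgroup_mulg_continuous subgroup_invg_continuous.

End SubgroupTopologicalGroup.

Section IdentityComponent.
Context (G : topologicalGroupType) (H : subgroup G).

Let C := connected_component H (1%g : G).

Lemma identity_component1 : C 1%g.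
Proof. by apply: connected_component_refl; exact: subgroup1. Qed.

Let C_translate (h : G) : subgroup_set H h -> forall x, C x ->
  connected_component H h (h * x)%g.
Proof.
move=> Hh x Cx; exists ((fun y : G => (h * y)%g) @` C); last by exists x.
split.
- by exists 1%g; [exact: identity_component1|rewrite mulg1].
- move=> _ [y /connected_component_sub Hy <-]; exact: subgroupM.
- apply: connected_continuous_connected; first exact: component_connected.
  by apply: continuous_subspaceT; exact: lmulg_continuous.
Qed.

Lemma identity_componentM x y : C x -> C y -> C (x * y)%g.
Proof.
move=> Cx Cy; apply: (connected_component_trans Cx).
by apply: C_translate => //; exact: connected_component_sub Cx.
Qed.

Lemma identity_componentV x : C x -> C (x^-1)%g.
Proof.
move=> Cx; apply: connected_component_sym.
have Hx : subgroup_set H (x^-1)%g by apply: subgroupV; exact: connected_component_sub Cx.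
by rewrite -[1%g](mulVg x); exact: C_translate.
Qed.

Definition identity_component : subgroup G :=
  Subgroup identity_component1 identity_componentM identity_componentV.

End IdentityComponent.

Section PreimageSubgroup.
Context (G H : groupType) (p : UMagmaMorphism.type G H).
Context (K : subgroup H).

Lemma preimage_subgroup1 : (p @^-1` K) 1%g.
Proof. by rewrite /preimage/= gmulf1; exact: subgroup1. Qed.

Lemma preimage_subgroupM x y :
  (p @^-1` K) x -> (p @^-1` K) y -> (p @^-1` K) (x * y)%g.
Proof. by rewrite /preimage/= gmulfM; exact: subgroupM. Qed.

Lemma preimage_subgroupV x : (p @^-1` K) x -> (p @^-1` K) (x^-1)%g.
Proof. by rewrite /preimage/= gmulfV; exact: subgroupV. Qed.

Definition preimage_subgroup : subgroup G :=
  Subgroup preimage_subgroup1 preimage_subgroupM preimage_subgroupV.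

End PreimageSubgroup.

(* All partial derivatives of order at most k exist and are continuous on U;
   only used with U open. *)
Fixpoint Ck_on (R : realType) (m n k : nat) (U : set 'rV[R]_m)
    (f : 'rV[R]_m -> 'rV[R]_n) : Prop :=
  (forall x, U x -> {for x, continuous f}) /\
  if k is k'.+1 then
    forall i : 'I_m, (forall x, U x -> derivable f x (delta_mx 0 i)) /\
      Ck_on k' U (fun x => 'D_(delta_mx 0 i) f x)
  else True.

Definition smooth_on (R : realType) (m n : nat) (U : set 'rV[R]_m)
    (f : 'rV[R]_m -> 'rV[R]_n) : Prop :=
  forall k, Ck_on k U f.

(* A homeomorphism between the open sets [chart_dom] and [chart_cod]; the values
   of the two maps elsewhere are irrelevant. *)
Record chart (R : realType) (n : nat) (M : topologicalType) := Chart {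
  chart_dom : set M;
  chart_cod : set 'rV[R]_n;
  chart_map : M -> 'rV[R]_n;
  chart_inv : 'rV[R]_n -> M;
  chart_dom_open : open chart_dom;
  chart_cod_open : open chart_cod;
  chart_mapP : forall x, chart_dom x -> chart_cod (chart_map x);
  chart_invP : forall y, chart_cod y -> chart_dom (chart_inv y);
  chart_mapK : forall x, chart_dom x -> chart_inv (chart_map x) = x;
  chart_invK : forall y, chart_cod y -> chart_map (chart_inv y) = y;
  chart_map_continuous : forall x, chart_dom x -> {for x, continuous chart_map};
  chart_inv_continuous : forall y, chart_cod y -> {for y, continuous chart_inv}
}.

Definition smooth_atlas (R : realType) (n : nat) (M : topologicalType)
    (A : set (chart R n M)) : Prop :=
  (forall x, exists2 c, A c & chart_dom c x) /\
  (forall c d, A c -> A d ->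
    smooth_on (chart_cod c `&` chart_inv c @^-1` chart_dom d)
      (chart_map d \o chart_inv c)).

Section SmoothGroupOperations.
Context (R : realType) (n : nat) (G : topologicalGroupType).
Context (A : set (chart R n G)).

(* The charts of the product manifold G * G are the products of charts of G,
   with values in 'rV_(n + n). *)
Definition smooth_mulg : Prop :=
  forall c1 c2 d, A c1 -> A c2 -> A d ->
  let mul_chart (z : 'rV[R]_(n + n)) : G :=
    (chart_inv c1 (lsubmx z) * chart_inv c2 (rsubmx z))%g in
  smooth_on
    [set z | [/\ chart_cod c1 (lsubmx z), chart_cod c2 (rsubmx z)
               & chart_dom d (mul_chart z)]]
    (chart_map d \o mul_chart).

Definition smooth_invg : Prop :=
  forall c d, A c -> A d ->
  let inv_chart (z : 'rV[R]_n) : G := ((chart_inv c z)^-1)%g in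
  smooth_on (chart_cod c `&` inv_chart @^-1` chart_dom d)
    (chart_map d \o inv_chart).

End SmoothGroupOperations.

Definition Lie_group (R : realType) (G : topologicalGroupType) : Prop :=
  [/\ hausdorff_space G, @second_countable G &
      exists (n : nat) (A : set (chart R n G)),
        [/\ smooth_atlas A, smooth_mulg A & smooth_invg A]].

Record finite_central_covering (R : realType) (Gt G : topologicalGroupType)
    (p : UMagmaMorphism.type Gt G) : Prop := FiniteCentralCovering {
  covering_Lie_group : Lie_group R Gt;
  covering_connected : connected [set: Gt];
  covering_continuous : continuous p;
  covering_surjective : set_surj [set: Gt] [set: G] p;
  covering_finite_kernel : finite_set (p @^-1` [set 1%g]);
  covering_central_kernel : forall z, p z = 1%g -> forall x, commute z x
}.

Section SingularCohomology.
Context (R : realType).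

Definition standard_simplex (n : nat) : set 'rV[R]_n.+1 :=
  [set t | (forall i, 0 <= t 0 i) /\ \sum_i t 0 i = 1].
Arguments standard_simplex : clear implicits.

Definition face_row (n : nat) (i : 'I_n.+2) (t : 'rV[R]_n.+1) : 'rV[R]_n.+2 :=
  \row_j (if unlift i j is Some k then t 0 k else 0).

Lemma face_row_simplex n (i : 'I_n.+2) (t : 'rV[R]_n.+1) :
  standard_simplex n t -> standard_simplex n.+1 (face_row i t).
Proof.
move=> [t_ge0 t_sum]; split=> [j|].
  by rewrite mxE; case: unlift => [k|]; [exact: t_ge0|exact: lexx].
rewrite (bigD1_ord i)//= mxE unlift_none add0r -[RHS]t_sum.
by apply: eq_bigr => k _; rewrite mxE liftK.
Qed.

Lemma face_row_continuous n (i : 'I_n.+2) : continuous (face_row i).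
Proof.
move=> t B [P tP PB]; rewrite nbhs_filterE.
pose f (kj : 'I_1 * 'I_n.+2) := [set u | P kj.1 kj.2 (face_row i u kj.1 kj.2)].
have : nbhs t [set u | forall kj, f kj u].
  apply: (@filter_forall _ _ f _ (nbhs_filter t)) => -[k j] /=.
  rewrite /f /=; have := tP k j; rewrite mxE.
  case ij : (unlift i j) => [l|] Pkj; last first.
    by apply: nearW => u /=; rewrite mxE ij; exact: nbhs_singleton Pkj.
  have : nbhs t [set u : 'rV[R]_n.+1 | P k j (u 0 l)].
    exact: (@coord_continuous R 1 n.+1 0 l t _ Pkj).
  by apply: filterS => u /=; rewrite mxE ij.
by apply: filterS => u Pu; apply: PB => k j; exact: (Pu (k, j)).
Qed.

Definition face_map (n : nat) (i : 'I_n.+2) (t : standard_simplex n) :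
    standard_simplex n.+1 :=
  exist _ (face_row i (val t)) (mem_set (face_row_simplex i (set_mem (valP t)))).

Lemma face_map_continuous n (i : 'I_n.+2) : continuous (face_map i).
Proof.
apply: continuous_comp_initial => t.
apply: (@continuous_comp _ _ _ set_val (face_row i)).
  exact: initial_continuous.
exact: face_row_continuous.
Qed.

HB.instance Definition _ n (i : 'I_n.+2) :=
  isContinuous.Build _ _ (face_map i) (@face_map_continuous n i).

Definition singular_simplex (X : topologicalType) (n : nat) : Type :=
  continuousType (standard_simplex n) X.

Definition cochain (X : topologicalType) (n : nat) : Type :=
  singular_simplex X n -> rat.

Definition coboundary_map (X : topologicalType) (n : nat) (phi : cochain X n) :
    cochain X n.+1 :=
  fun s => \sum_(i < n.+2) (-1) ^+ i * phi (s \o face_map i).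

Definition cocycle (X : topologicalType) (n : nat) : set (cochain X n) :=
  [set phi | forall s, coboundary_map phi s = 0].
Arguments cocycle : clear implicits.

Definition coboundary (X : topologicalType) (n : nat) : set (cochain X n) :=
  if n is n'.+1 then range (@coboundary_map X n') else [set fun=> 0].
Arguments coboundary : clear implicits.

Lemma coboundary_mapB (X : topologicalType) n (phi psi : cochain X n) s :
  coboundary_map (fun t => phi t - psi t) s =
  coboundary_map phi s - coboundary_map psi s.
Proof.
rewrite /coboundary_map -sumrB; apply: eq_bigr => i _.
by rewrite mulrBr.
Qed.

Lemma coboundary0 (X : topologicalType) n : coboundary X n (fun=> 0).
Proof.
case: n => [//|n]; exists (fun=> 0) => //; apply/funext => s.
by rewrite /coboundary_map big1// => i _; rewrite mulr0.
Qed.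

Lemma coboundaryB (X : topologicalType) n (phi psi : cochain X n) :
  coboundary X n phi -> coboundary X n psi ->
  coboundary X n (fun s => phi s - psi s).
Proof.
case: n phi psi => [|n] phi psi /=.
  by move=> -> ->; apply/funext => s; rewrite subrr.
move=> [a _ <-] [b _ <-]; exists (fun s => a s - b s) => //.
by apply/funext => s; exact: coboundary_mapB.
Qed.

(* Since cohomology is defined as a quotient of the set of cocycles, the
   identity [coboundary `<=` cocycle] is not needed for the definition. *)
Definition cohomologous (X : topologicalType) (n : nat) (z w : cocycle X n) :
    bool :=
  `[< coboundary X n (fun s => val z s - val w s) >].

Lemma cohomologous_refl X n : reflexive (@cohomologous X n).
Proof.
move=> z; apply/asboolP; have := @coboundary0 X n; congr coboundary.
by apply/funext => s; rewrite subrr.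
Qed.

Lemma cohomologous_sym X n : symmetric (@cohomologous X n).
Proof.
suff sub z w : @cohomologous X n z w -> cohomologous w z.
  by move=> z w; apply/idP/idP; exact: sub.
move=> /asboolP zw; apply/asboolP.
have := coboundaryB (@coboundary0 X n) zw; congr coboundary.
by apply/funext => s; rewrite sub0r opprB.
Qed.

Lemma cohomologous_trans X n : transitive (@cohomologous X n).
Proof.
move=> y x z /asboolP xy; rewrite cohomologous_sym => /asboolP zy.
apply/asboolP; have := coboundaryB xy zy; congr coboundary.
by apply/funext => s; rewrite opprB addrA subrK.
Qed.

Canonical cohomologous_equiv X n := EquivRel (@cohomologous X n)
  (@cohomologous_refl X n) (@cohomologous_sym X n) (@cohomologous_trans X n).

Definition cohomology (X : topologicalType) (n : nat) : Type :=
  {eq_quot (cohomologous_equiv X n)}.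

Definition cohomology_class (X : topologicalType) n (z : cocycle X n) :
    cohomology X n :=
  \pi_({eq_quot (cohomologous_equiv X n)}) z.

Definition representative (X : topologicalType) n (c : cohomology X n) :
    cocycle X n :=
  repr (c : {eq_quot (cohomologous_equiv X n)}).

Lemma representativeK (X : topologicalType) n :
  cancel (@representative X n) (@cohomology_class X n).
Proof. exact: reprK. Qed.

Lemma cohomology_classP (X : topologicalType) n (z w : cocycle X n) :
  cohomology_class z = cohomology_class w <->
  coboundary X n (fun s => val z s - val w s).
Proof. by split=> [/eqmodP/asboolP//|?]; apply/eqmodP/asboolP. Qed.

Definition pullback (X Y : topologicalType) (f : continuousType X Y) (n : nat)
    (phi : cochain Y n) : cochain X n :=
  fun s => phi (f \o s).

Lemma pullback_cocycle (X Y : topologicalType) (f : continuousType X Y) n (phi : cochain Y n) :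
  cocycle Y n phi -> cocycle X n (pullback f phi).
Proof.
move=> phi0 s; rewrite -[RHS](phi0 (f \o s)).
apply: eq_bigr => i _; rewrite /pullback; congr (_ * phi _).
exact/continuousEP.
Qed.

Definition cocycle_map (X Y : topologicalType) (f : continuousType X Y) (n : nat)
    (z : cocycle Y n) : cocycle X n :=
  exist _ (pullback f (val z))
    (mem_set (pullback_cocycle f (set_mem (valP z)))).

Definition cohomology_map (X Y : topologicalType) (f : continuousType X Y)
    (n : nat) (c : cohomology Y n) : cohomology X n :=
  cohomology_class (cocycle_map f (representative c)).

Lemma coboundary_map_pullback (X Y : topologicalType) (f : continuousType X Y)
    n (phi : cochain Y n) :
  coboundary_map (pullback f phi) = pullback f (coboundary_map phi).
Proof.
apply/funext => s; apply: eq_bigr => i _; rewrite /pullback; congr (_ * phi _).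
exact/continuousEP.
Qed.

Lemma cohomology_map_class (X Y : topologicalType) (f : continuousType X Y)
    n (z : cocycle Y n) :
  cohomology_map f (cohomology_class z) = cohomology_class (cocycle_map f z).
Proof.
apply/cohomology_classP => /=.
have /cohomology_classP := representativeK (cohomology_class z).
move: (representative _) => w; case: n z w => [|n] z w /= zw.
  by apply/funext => s; have := congr1 (fun phi : cochain Y 0 => phi (f \o s)) zw.
case: zw => psi _ psiE; exists (pullback f psi) => //.
by rewrite coboundary_map_pullback psiE.
Qed.

End SingularCohomology.

Record left_action (H : topologicalGroupType) (X : topologicalType) :=
  LeftAction {
  lact :> H -> X -> X;
  lact1 : forall x, lact 1%g x = x;
  lactM : forall g h x, lact (g * h)%g x = lact g (lact h x);
  lact_continuous : continuous (fun z : H * X => lact z.1 z.2)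
}.

(* (triv, coord) is an H-equivariant homeomorphism triv from U * H onto the
   preimage of U, over U, with inverse e |-> (proj e, coord e). *)
Record local_trivialization (H : topologicalGroupType) (E B : topologicalType)
    (proj : E -> B) (act : E -> H -> E) (U : set B)
    (triv : B * H -> E) (coord : E -> H) : Prop := LocalTrivialization {
  triv_proj : forall x h, U x -> proj (triv (x, h)) = x;
  triv_coord : forall x h, U x -> coord (triv (x, h)) = h;
  coordK : forall e, U (proj e) -> triv (proj e, coord e) = e;
  triv_act : forall x g h, U x -> triv (x, (g * h)%g) = act (triv (x, g)) h;
  triv_continuous : forall z, U z.1 -> {for z, continuous triv};
  trivialization_coord_continuous : forall e, U (proj e) -> {for e, continuous coord}
}.

Record principal_bundle (H : topologicalGroupType) := PrincipalBundle {
  total_space : topologicalType;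
  base_space : topologicalType;
  bundle_proj : total_space -> base_space;
  ract : total_space -> H -> total_space;
  bundle_proj_continuous : continuous bundle_proj;
  ract1 : forall e, ract e 1%g = e;
  ractM : forall e g h, ract e (g * h)%g = ract (ract e g) h;
  ract_continuous : continuous (fun z : total_space * H => ract z.1 z.2);
  bundle_locally_trivial : forall b, exists U triv coord,
    [/\ open U, U b & local_trivialization bundle_proj ract U triv coord]
}.

Definition contractible (R : realType) (X : topologicalType) : Prop :=
  exists (x0 : X) (F : X * R -> X),
    [/\ {within [set z | 0 <= z.2 <= 1], continuous F},
        (forall x, F (x, 0) = x) & (forall x, F (x, 1) = x0)].

Record universal_bundle (R : realType) (H : topologicalGroupType) :=
  UniversalBundle {
  universal_principal :> principal_bundle H;
  universal_contractible : contractible R (total_space universal_principal)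
}.

Section HomotopyQuotient.
Context (H : topologicalGroupType) (P : principal_bundle H).
Context (X : topologicalType) (a : left_action H X).

Local Notation E := (total_space P).

(* z is (e h, x) and w is (e, h x) for some h *)
Definition borel_rel (z w : E * X) : bool :=
  `[< exists h, z.1 = ract w.1 h /\ w.2 = a h z.2 >].

Lemma borel_rel_refl : reflexive borel_rel.
Proof. by move=> z; apply/asboolP; exists 1%g; rewrite ract1 lact1. Qed.

Lemma borel_rel_sym : symmetric borel_rel.
Proof.
suff sub z w : borel_rel z w -> borel_rel w z.
  by move=> z w; apply/idP/idP; exact: sub.
move=> /asboolP[h [zw wz]]; apply/asboolP; exists (h^-1)%g.
by rewrite zw wz -ractM -lactM mulgV mulVg ract1 lact1.
Qed.

Lemma borel_rel_trans : transitive borel_rel.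
Proof.
move=> y x z /asboolP[g [xy yx]] /asboolP[h [yz zy]]; apply/asboolP.
by exists (h * g)%g; rewrite ractM lactM -yz -xy -yx -zy.
Qed.

Canonical borel_equiv :=
  EquivRel borel_rel borel_rel_refl borel_rel_sym borel_rel_trans.

Definition homotopy_quotient : topologicalType :=
  quotient_topology {eq_quot borel_equiv}.

Definition fiber_inclusion (e : E) (x : X) : homotopy_quotient :=
  \pi_(quotient_topology {eq_quot borel_equiv}) (e, x).

Lemma fiber_inclusion_continuous e : continuous (fiber_inclusion e).
Proof.
move=> x; apply: (@continuous_comp _ _ _ (fun x : X => (e, x))).
  by apply: cvg_pair => /=; [exact: cvg_cst|exact: cvg_id].
exact: pi_continuous.
Qed.

HB.instance Definition _ e :=
  isContinuous.Build _ _ (fiber_inclusion e) (@fiber_inclusion_continuous e).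

End HomotopyQuotient.
Arguments homotopy_quotient {H} P {X} a.
Arguments fiber_inclusion {H} P {X} a e x.

(* The total space of a universal bundle being nonempty and path-connected, the
   homotopy class of the inclusion of the fiber does not depend on e. *)
Definition equivariantly_formal (R : realType) (H : topologicalGroupType)
    (EH : universal_bundle R H) (X : topologicalType) (a : left_action H X) :
    Prop :=
  forall (e : total_space EH) (n : nat),
    set_surj [set: cohomology R (homotopy_quotient EH a) n]
      [set: cohomology R X n]
      (@cohomology_map R _ _ (fiber_inclusion EH a e) n).

Section CosetSpace.
Context (G : topologicalGroupType) (K : subgroup G).

Definition coset_rel (x y : G) : bool := `[< subgroup_set K (x^-1 * y)%g >].

Lemma coset_rel_refl : reflexive coset_rel.
Proof. by move=> x; apply/asboolP; rewrite mulVg; exact: subgroup1. Qed.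

Lemma coset_rel_sym : symmetric coset_rel.
Proof.
suff sub x y : coset_rel x y -> coset_rel y x.
  by move=> x y; apply/idP/idP; exact: sub.
by move=> /asboolP/subgroupV; rewrite invgM invgK => ?; exact/asboolP.
Qed.

Lemma coset_rel_trans : transitive coset_rel.
Proof.
move=> y x z /asboolP Kxy /asboolP Kyz; apply/asboolP.
by have := subgroupM Kxy Kyz; rewrite mulgA mulgK.
Qed.

Canonical coset_equiv :=
  EquivRel coset_rel coset_rel_refl coset_rel_sym coset_rel_trans.

Local Notation coset_quot := (quotient_topology {eq_quot coset_equiv}).

Definition coset_space : topologicalType := coset_quot.

Definition coset_pi (x : G) : coset_space := \pi_coset_quot x.

Lemma coset_piP (x y : G) :
  coset_pi x = coset_pi y <-> subgroup_set K (x^-1 * y)%g.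
Proof.
split=> [/eqmodP/asboolP//|Kxy].
by apply/eqmodP/asboolP.
Qed.

Lemma coset_pi_continuous : continuous coset_pi.
Proof. exact: pi_continuous. Qed.

Lemma coset_pi_open (U : set G) : open U -> open (coset_pi @` U).
Proof.
move=> oU; rewrite /open/= /quotient_open.
rewrite (_ : _ @^-1` _ =
    \bigcup_(k in subgroup_set K) ((fun x : G => (x * k)%g) @^-1` U)).
  apply: bigcup_open => k _; apply: open_comp => // x _.
  exact: rmulg_continuous.
apply/seteqP; split=> [x [y Uy /coset_piP Kyx]|x [k Kk Uxk]].
  exists (x^-1 * y)%g; last by rewrite /preimage/= mulVKg.
  by have := subgroupV Kyx; rewrite invgM invgK.
by exists (x * k)%g => //; apply/coset_piP; rewrite invgM mulgVK; exact: subgroupV.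
Qed.

Definition isotropy_map (k : set_type K) (c : coset_space) : coset_space :=
  coset_pi (val k * repr (c : coset_quot))%g.

Lemma isotropy_map_pi (k : set_type K) (x : G) :
  isotropy_map k (coset_pi x) = coset_pi (val k * x)%g.
Proof.
apply/coset_piP; rewrite invgM -mulgA mulKg.
by apply/coset_piP; rewrite /coset_pi reprK.
Qed.

Lemma coset_piK (c : coset_space) : coset_pi (repr (c : coset_quot)) = c.
Proof. exact: reprK. Qed.

Lemma isotropy_map1 c : isotropy_map 1%g c = c.
Proof. by rewrite -(coset_piK c) isotropy_map_pi mul1g. Qed.

Lemma isotropy_mapM g h c :
  isotropy_map (g * h)%g c = isotropy_map g (isotropy_map h c).
Proof. by rewrite -(coset_piK c) !isotropy_map_pi mulgA. Qed.

Lemma isotropy_map_continuous :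
  continuous (fun z : set_type K * coset_space => isotropy_map z.1 z.2).
Proof.
move=> [k c] W /=; rewrite -(coset_piK c); set x := repr _.
rewrite isotropy_map_pi => /coset_pi_continuous.
move=> /(@mulg_continuous G (val k, x)) [[A B] /= [Ak Bx] ABW].
exists (val @^-1` A, coset_pi @` B°) => /=.
  split; first exact: (@initial_continuous _ _ set_val k).
  apply: (@open_nbhs_nbhs _ (coset_pi x)); split.
    by apply: coset_pi_open; exact: open_interior.
  by exists x.
move=> [h d] /= [Ah [y /interior_subset By <-]]; rewrite isotropy_map_pi.
exact: (ABW (val h, y)).
Qed.

Definition isotropy_action : left_action (set_type K) coset_space :=
  LeftAction isotropy_map1 isotropy_mapM isotropy_map_continuous.

End CosetSpace.

Definition isotropy_formal (R : realType) (G : topologicalGroupType)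
    (K : subgroup G) (EK : universal_bundle R (set_type K)) : Prop :=
  equivariantly_formal EK (isotropy_action K).
Arguments isotropy_formal {R G} K EK.

(* Main.v *)
(* Write H for the group K~_0 and Z for the kernel of the covering p : Gt -> G, so
   that Gt/H -> G/K is a covering whose deck group is a quotient of Z. As Z lies
   in the path-connected group Gt acting on Gt/H, it acts trivially on the
   cohomology of Gt/H, and averaging over Z identifies it with that of G/K.

   On the Borel constructions, a singular simplex of (E x X)/H is an orbit of
   Sing(H) on Sing(E) x Sing(X). Since EK is contractible, there is an
   H-equivariant map Sing(EH) -> Sing(EK) compatible with faces, built orbit by
   orbit; composition with it turns cocycles on the Borel construction of G/K
   into cocycles on that of Gt/H. Conversely the finite group N, the intersection
   of H and Z, acts freely on EH, so only a multivalued map Sing(EK) -> Sing(EH)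
   exists: it depends on a lift to H of a K-coordinate of each vertex, and one
   averages over the N^(n+1) choices. A prism operator shows that the averaging
   does not change the restriction to the fibre. *)
Require Import Defs.
From HB Require Import structures.
From mathcomp Require Import all_boot all_order all_algebra.
From mathcomp Require Import all_classical all_reals all_analysis.
From mathcomp Require Import zify lra.

Set Implicit Arguments.
Unset Strict Implicit.
Unset Printing Implicit Defensive.

Import Order.TTheory GRing.Theory Num.Theory.
Import numFieldNormedType.Exports.

Local Open Scope classical_set_scope.
Local Open Scope ring_scope.
Local Open Scope quotient_scope.

(** * Simplices *)

(** The universal bundles are arbitrary contractible ones without cell structure, so no continuous
    equivariant map between them is at hand; this is why equivariant maps are built on singular
    simplices only. Formality asks just for surjectivity onto the cohomology of the fibre, so each
    direction transports a single cocycle and computes its restriction to the fibre. The descent is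
    the harder direction because H acts on Sing(EK) with kernel N. Labels in H at the vertices make
    the action free, but labels chosen from the simplex are equivariant only up to an element of N
    at each vertex, independently. The averaged cochain is compared with the unaveraged one through
    cochains in which only the first k labels are averaged. The covering is merely a continuous
    surjective homomorphism from a connected Lie group with finite central kernel. Its openness, on
    which all lifting of simplices to Gt/H and H rests, comes from an open mapping argument; this is
    where compactness of G enters. *)

Lemma row_continuous (R : realType) (T : topologicalType) (n : nat)
    (f : T -> 'rV[R]_n) (x : T) :
  (forall j, {for x, continuous (fun t => f t 0 j)}) -> {for x, continuous f}.
Proof.
move=> fc B [P tP PB]; rewrite nbhs_filterE.
pose Q (ij : 'I_1 * 'I_n) := [set u | P ij.1 ij.2 (f u ij.1 ij.2)].
have : nbhs x [set u | forall ij, Q ij u].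
  apply: (@filter_forall _ _ Q _ (nbhs_filter x)) => -[i j] /=.
  by rewrite /Q /=; have := tP i j; rewrite (ord1 i); exact: fc.
by apply: filterS => u Qu; apply: PB => i j; exact: (Qu (i, j)).
Qed.

Lemma pair_continuous (T X Y : topologicalType) (f : T -> X) (g : T -> Y) (x : T) :
  {for x, continuous f} -> {for x, continuous g} ->
  {for x, continuous (fun t => (f t, g t))}.
Proof. by move=> fc gc; exact: cvg_pair. Qed.

Lemma continuous_comp2 (T X Y W : topologicalType) (f : T -> X) (g : T -> Y)
    (h : X * Y -> W) (x : T) :
  {for x, continuous f} -> {for x, continuous g} ->
  {for (f x, g x), continuous h} -> {for x, continuous (fun t => h (f t, g t))}.
Proof.
move=> fc gc hc; apply: (@continuous_comp _ _ _ (fun t => (f t, g t)) h) => //.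
exact: pair_continuous.
Qed.

Lemma set_type_continuous (T X : topologicalType) (A : set X)
    (f : T -> set_type A) :
  continuous (fun t => val (f t)) -> continuous f.
Proof. by move=> fc; apply: continuous_comp_initial. Qed.

Lemma val_continuous (X : topologicalType) (A : set X) :
  continuous (fun a : set_type A => val a).
Proof. by move=> x; exact: initial_continuous. Qed.

Lemma continuous_near (T X : topologicalType) (f : T -> X) (x : T) (W : set X) :
  {for x, continuous f} -> nbhs (f x) W -> \forall t \near x, W (f t).
Proof. by move=> fc; exact: fc. Qed.

Lemma near_continuous (T X : topologicalType) (f g : T -> X) (x : T) :
  (\forall t \near x, f t = g t) -> {for x, continuous f} ->
  {for x, continuous g}.
Proof.
move=> fg fc; have fgx : f x = g x := nbhs_singleton fg.
move=> W; rewrite -fgx => /fc fW; rewrite nbhs_filterE.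
apply: filterS2 fg fW => t.
by rewrite /preimage /= => ->.
Qed.

Lemma glue_continuous (R : realType) (T X : topologicalType) (k : T -> R)
    (f g : T -> X) :
  continuous k -> continuous f -> continuous g ->
  (forall t, k t = 0 -> f t = g t) ->
  continuous (fun t => if k t <= 0 then f t else g t).
Proof.
move=> kc fc gc fg t; case: (ltgtP (k t) 0) => kt.
- apply: (near_continuous _ (fc t)).
  have kn : \forall u \near t, k u < 0 by exact: (kc t _ (lt_nbhsl kt)).
  by apply: filterS kn => u /= /ltW ->.
- apply: (near_continuous _ (gc t)).
  have kp : \forall u \near t, 0 < k u by exact: (kc t _ (lt_nbhsr kt)).
  by apply: filterS kp => u /=; rewrite leNgt => ->.
- move=> W /=; rewrite kt lexx => Wf; have Wg := Wf; rewrite fg// in Wg.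
  have Wfn := continuous_near (fc t) Wf; have Wgn := continuous_near (gc t) Wg.
  suff : \forall u \near t, W (if k u <= 0 then f u else g u) by [].
  by apply: filterS2 Wfn Wgn => u /= Wfu Wgu; case: ifP.
Qed.

Section RealFunctions.
Context (R : realType) (T : topologicalType).
Implicit Types (f g : T -> R) (x : T).

Lemma fun_maxr_continuous f g x : {for x, continuous f} -> {for x, continuous g} ->
  {for x, continuous (fun t => Num.max (f t) (g t))}.
Proof. exact: continuous_max. Qed.

Lemma fun_minr_continuous f g x : {for x, continuous f} -> {for x, continuous g} ->
  {for x, continuous (fun t => Num.min (f t) (g t))}.
Proof. exact: continuous_min. Qed.

Lemma fun_addr_continuous f g x : {for x, continuous f} -> {for x, continuous g} ->
  {for x, continuous (fun t => f t + g t)}.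
Proof. by move=> fc gc; exact: (continuousD fc gc). Qed.

Lemma fun_subr_continuous f g x : {for x, continuous f} -> {for x, continuous g} ->
  {for x, continuous (fun t => f t - g t)}.
Proof. by move=> fc gc; exact: (continuousB fc gc). Qed.

Lemma fun_mulr_continuous f g x : {for x, continuous f} -> {for x, continuous g} ->
  {for x, continuous (fun t => f t * g t)}.
Proof. by move=> fc gc; exact: (continuousM fc gc). Qed.

Lemma fun_invr_continuous f x : f x != 0 -> {for x, continuous f} ->
  {for x, continuous (fun t => (f t)^-1)}.
Proof. by move=> fx0 fc; exact: (continuousV fx0 fc). Qed.

End RealFunctions.

Section Simplices.
Context (R : realType).

Local Notation Delta n := (@standard_simplex R n).
Local Notation Sing := (singular_simplex R).

Definition to_simplex (X : topologicalType) (n : nat) (f : Delta n -> X)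
    (fc : continuous f) : Sing X n :=
  HB.pack_for (continuousType (Delta n) X) f (isContinuous.Build _ _ f fc).

Definition const_simplex (X : topologicalType) (n : nat) (x : X) : Sing X n :=
  to_simplex (@cst_continuous (Delta n) X x).

Lemma map_simplex_continuous (X Y : topologicalType) (n : nat) (f : X -> Y)
    (s : Sing X n) : continuous f -> continuous (fun t => f (s t)).
Proof.
by move=> fc t; apply: (@continuous_comp _ _ _ s f); [exact: cts_fun|exact: fc].
Qed.

Definition map_simplex (X Y : topologicalType) (n : nat) (f : X -> Y)
    (fc : continuous f) (s : Sing X n) : Sing Y n :=
  to_simplex (@map_simplex_continuous X Y n f s fc).

Lemma simplexP (X : topologicalType) n (s u : Sing X n) : s =1 u -> s = u.
Proof. by move=> su; exact/continuousEP. Qed.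

Lemma simplex_ge0 n (t : Delta n) i : 0 <= val t 0 i.
Proof. by have [] := set_mem (valP t). Qed.

Lemma simplex_sum n (t : Delta n) : \sum_i val t 0 i = 1.
Proof. by have [] := set_mem (valP t). Qed.

Lemma DeltaP n (t u : Delta n) : (forall i, val t 0 i = val u 0 i) -> t = u.
Proof. by move=> tu; apply: val_inj; apply/rowP. Qed.

Definition push_row m n (th : 'I_m.+1 -> 'I_n.+1) (t : 'rV[R]_m.+1) : 'rV[R]_n.+1 :=
  \row_k \sum_(j | th j == k) t 0 j.

Lemma push_row_simplex m n (th : 'I_m.+1 -> 'I_n.+1) (t : Delta m) :
  Delta n (push_row th (val t)).
Proof.
split=> [i|]; first by rewrite mxE sumr_ge0// => j _; exact: simplex_ge0.
under eq_bigr do rewrite mxE.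
by rewrite -[RHS](simplex_sum t) [RHS](partition_big th xpredT).
Qed.

(** The affine map given by a map of vertices. Faces and degeneracies are both of this form, so
    simplicial identities reduce to arithmetic on vertex indices. *)
Definition push m n (th : 'I_m.+1 -> 'I_n.+1) (t : Delta m) : Delta n :=
  exist _ (push_row th (val t)) (mem_set (push_row_simplex th t)).

Lemma pushE m n (th : 'I_m.+1 -> 'I_n.+1) (t : Delta m) k :
  val (push th t) 0 k = \sum_(j | th j == k) val t 0 j.
Proof. by rewrite /= mxE. Qed.

Lemma coord_simplex_continuous n (k : 'I_n.+1) :
  continuous (fun t : Delta n => val t 0 k).
Proof.
move=> t; apply: (@continuous_comp _ _ _ (fun t : Delta n => val t)
  (fun u : 'rV[R]_n.+1 => u 0 k)); first exact: val_continuous.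
exact: coord_continuous.
Qed.

Lemma sum_continuous (T : topologicalType) (I : Type) (r : seq I) (P : pred I)
    (f : I -> T -> R) :
  (forall i, continuous (f i)) -> continuous (fun t => \sum_(i <- r | P i) f i t).
Proof.
move=> fc x; rewrite /continuous_at; apply: (@cvg_big _ _ +%R 0 P _ T _ r f).
  exact: add_continuous.
by move=> i _; exact: fc.
Qed.

Lemma push_continuous m n (th : 'I_m.+1 -> 'I_n.+1) : continuous (push th).
Proof.
apply: set_type_continuous => t; apply: row_continuous => k /=.
rewrite (_ : (fun _ => _) = (fun t : Delta m => \sum_(j | th j == k) val t 0 j)).
  by apply: sum_continuous => j; exact: coord_simplex_continuous.
by apply/funext => u; rewrite mxE.
Qed.

Lemma push_comp m n p (th : 'I_n.+1 -> 'I_p.+1) (et : 'I_m.+1 -> 'I_n.+1) t :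
  push th (push et t) = push (th \o et) t.
Proof.
apply: DeltaP => k; rewrite !pushE.
under eq_bigr do rewrite pushE.
rewrite (exchange_big_dep (fun j => th (et j) == k))/=; last first.
  by move=> i j /eqP <- /eqP ->.
apply: eq_bigr => j /eqP thk; rewrite (big_pred1 (et j))// => i.
by rewrite /= [et j == i]eq_sym andb_idl// => /eqP ->; apply/eqP.
Qed.

Lemma eq_push m n (th et : 'I_m.+1 -> 'I_n.+1) t :
  th =1 et -> push th t = push et t.
Proof.
by move=> te; apply: DeltaP => k; rewrite !pushE; apply: eq_bigl => j; rewrite te.
Qed.

Lemma push_id n (t : Delta n) : push id t = t.
Proof. by apply: DeltaP => k; rewrite pushE big_pred1_eq. Qed.

Lemma face_mapE n (i : 'I_n.+2) (t : Delta n) : face_map i t = push (lift i) t.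
Proof.
apply: DeltaP => k; rewrite pushE /= mxE.
case: unliftP => [j ->|->].
  by rewrite (big_pred1 j)// => l; rewrite /= (inj_eq lift_inj).
by rewrite big1// => j /eqP /esym/eqP; rewrite (negbTE (neq_lift _ _)).
Qed.

Lemma point_simplex_subproof : Delta 0 (const_mx 1).
Proof. by split=> [i|]; rewrite ?big_ord1 mxE ?ler01. Qed.

Definition point_simplex : Delta 0 :=
  exist _ (const_mx 1) (mem_set point_simplex_subproof).

Definition vertex n (k : 'I_n.+1) : Delta n :=
  push (fun _ : 'I_1 => k) point_simplex.

Lemma push_vertex m n (th : 'I_m.+1 -> 'I_n.+1) k : push th (vertex k) = vertex (th k).
Proof. by rewrite /vertex push_comp. Qed.

Lemma face_map_vertex n (i : 'I_n.+2) k : face_map i (vertex k) = vertex (lift i k).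
Proof. by rewrite face_mapE push_vertex. Qed.

(** Negative coordinates are cut off. If the rest sums to S < 1, the deficit is spread evenly; if S
    >= 1, one divides by S. The denominator [Num.max 1 S] never vanishes, so one formula is
    continuous everywhere. *)
Definition simplex_retr_row n (t : 'rV[R]_n.+1) : 'rV[R]_n.+1 :=
  let S := \sum_i Num.max (t 0 i) 0 in
  \row_i ((Num.max (t 0 i) 0 + Num.max (1 - S) 0 / n.+1%:R) / Num.max 1 S).

Lemma simplex_retr_simplex n (t : 'rV[R]_n.+1) : Delta n (simplex_retr_row t).
Proof.
rewrite /simplex_retr_row; set S := \sum_i _.
split=> [i|].
  rewrite mxE divr_ge0 ?le_max ?ler01//.
  by rewrite addr_ge0 ?divr_ge0// le_max lexx orbT.
under eq_bigr do rewrite mxE.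
rewrite -mulr_suml big_split/= -/S sumr_const card_ord -[_ *+ _]mulr_natr.
rewrite mulfVK ?pnatr_eq0//; have [S1|S1] := leP 1 S.
  by rewrite max_r ?subr_le0// addr0 divff// gt_eqF// (lt_le_trans ltr01).
by rewrite max_l ?subr_ge0 1?ltW// addrC subrK divr1.
Qed.

(* A retraction onto the simplex, used to extend simplices to the whole of 'rV. *)
Definition simplex_retr n (t : 'rV[R]_n.+1) : Delta n :=
  exist _ (simplex_retr_row t) (mem_set (simplex_retr_simplex t)).

Lemma simplex_retrK n (t : Delta n) : simplex_retr (val t) = t.
Proof.
apply: DeltaP => k; rewrite /= /simplex_retr_row /=.
have -> : \sum_i Num.max (val t 0 i) 0 = 1.
  rewrite -[RHS](simplex_sum t); apply: eq_bigr => i _.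
  by rewrite max_l// simplex_ge0.
by rewrite mxE subrr !maxxx mul0r addr0 divr1 max_l// simplex_ge0.
Qed.

Lemma simplex_retr_continuous n : continuous (@simplex_retr n).
Proof.
have maxc i : continuous (fun t : 'rV[R]_n.+1 => Num.max (t 0 i) 0).
  by move=> t; apply: fun_maxr_continuous; [exact: coord_continuous|exact: cst_continuous].
pose S (t : 'rV[R]_n.+1) := \sum_i Num.max (t 0 i) 0.
have Sc : continuous S by exact: sum_continuous.
apply: set_type_continuous => t; apply: row_continuous => k /=.
rewrite (_ : (fun _ => _) = (fun t : 'rV[R]_n.+1 => (Num.max (t 0 k) 0 +
   Num.max (1 - S t) 0 / n.+1%:R) / Num.max 1 (S t))); last first.
  by apply/funext => u; rewrite mxE.
apply: fun_mulr_continuous; last first.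
  apply: fun_invr_continuous; first by rewrite gt_eqF// lt_max ltr01.
  by apply: fun_maxr_continuous; [exact: cst_continuous|exact: Sc].
apply: fun_addr_continuous; first exact: maxc.
apply: fun_mulr_continuous; last exact: cst_continuous.
apply: fun_maxr_continuous; last exact: cst_continuous.
by apply: fun_subr_continuous; [exact: cst_continuous|exact: Sc].
Qed.

End Simplices.

Lemma near_forall (T : topologicalType) (I : finType) (x : T) (P : I -> T -> Prop) :
  (forall i, \forall t \near x, P i t) -> \forall t \near x, forall i, P i t.
Proof. exact: (@filter_forall _ _ (fun i => [set t | P i t]) _ (nbhs_filter x)). Qed.

Lemma within_continuous_comp (T X Y : topologicalType) (A : set X) (g : T -> X)
    (f : X -> Y) :
  {within A, continuous f} -> continuous g -> (forall t, A (g t)) ->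
  continuous (f \o g).
Proof.
move=> /subspace_continuousP fc gc gA t W Wfgt.
have fW : nbhs (g t) [set y | A y -> W (f y)] by exact: (fc _ (gA t) W Wfgt).
have gW : \forall u \near t, A (g u) -> W (f (g u)) by exact: (gc t _ fW).
suff : \forall u \near t, W (f (g u)) by [].
by apply: filterS gW => u; exact.
Qed.

(** Clamping the time to [0, 1] makes the homotopy continuous for all real times, which avoids the
    subspace topology from here on. *)
Lemma total_contraction (R : realType) (X : topologicalType) :
  contractible R X -> exists (x0 : X) (F : X * R -> X),
    [/\ continuous F, (forall x s, s <= 0 -> F (x, s) = x) &
        (forall x s, 1 <= s -> F (x, s) = x0)].
Proof.
move=> [x0 [F [Fc F0 F1]]].
pose c (z : X * R) : X * R := (z.1, Num.max 0 (Num.min 1 z.2)).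
exists x0, (F \o c); split.
- apply: within_continuous_comp Fc _ _.
    move=> z; apply: pair_continuous; first exact: cvg_fst.
    apply: fun_maxr_continuous; first exact: cst_continuous.
    by apply: fun_minr_continuous; [exact: cst_continuous|exact: cvg_snd].
  by move=> z /=; rewrite le_max lexx/= ge_max ler01 ge_min lexx.
- move=> x s s0 /=; rewrite /c/= min_r ?(le_trans s0)// max_l//.
- by move=> x s s1 /=; rewrite /c/= min_l// max_r.
Qed.

Section BoundaryFiller.
Context (R : realType) (E : topologicalType) (Ec : contractible R E) (n : nat).
Context (y : 'I_n.+2 -> singular_simplex R E n).
Hypothesis y_compat : forall i j t u, face_map i t = face_map j u -> y i t = y j u.

Local Notation Delta n := (@standard_simplex R n).
Local Notation N := (n.+2%:R : R).

Let least (t : Delta n.+1) (i : 'I_n.+2) := forall j, val t 0 i <= val t 0 j.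

(* The point where the ray from the barycentre through t meets the face i. *)
Let radial_row (i : 'I_n.+2) (t : Delta n.+1) : 'rV[R]_n.+1 :=
  \row_k ((val t 0 (lift i k) - val t 0 i) / (1 - N * val t 0 i)).

(** The retraction only makes [radial] total: where coordinate i is least and t is not the
    barycentre, [radial_row i t] already lies in the simplex. *)
Let radial i t : Delta n := simplex_retr (radial_row i t).

Let radialE (i : 'I_n.+2) (t : Delta n.+1) : least t i -> N * val t 0 i < 1 ->
  forall k, val (face_map i (radial i t)) 0 k =
            (val t 0 k - val t 0 i) / (1 - N * val t 0 i).
Proof.
move=> ti t1; set u := radial_row i t.
have d0 : 0 < 1 - N * val t 0 i by rewrite subr_gt0.
have uD : Delta n u.
  split=> [k|]; first by rewrite mxE divr_ge0 ?subr_ge0// ltW.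
  under eq_bigr do rewrite mxE.
  rewrite -mulr_suml sumrB sumr_const card_ord.
  have -> : \sum_(k < n.+1) val t 0 (lift i k) = 1 - val t 0 i.
    by rewrite -[1](simplex_sum t) (bigD1_ord i)// [RHS]addrC addKr.
  have -> : 1 - val t 0 i - val t 0 i *+ n.+1 = 1 - N * val t 0 i.
    by rewrite -addrA -opprD -mulrS mulr_natl.
  by rewrite divff// gt_eqF.
have -> : radial i t = exist _ u (mem_set uD) by rewrite -[RHS]simplex_retrK.
move=> k; rewrite /= mxE; case: unliftP => [j ->|->]; first by rewrite mxE.
by rewrite subrr mul0r.
Qed.

(** The simplex is the cone over its boundary. N times the least coordinate grows from 0 on the
    boundary to 1 at the barycentre, so it can serve as the time of the contraction along each
    ray. *)
Lemma boundary_filler :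
  exists s : singular_simplex R E n.+1, forall i t, s (face_map i t) = y i t.
Proof.
have [x0 [F [Fc F0 F1]]] := total_contraction Ec.
(* The contraction is run at double speed, so that the cone is constant near
   the barycentre, where [radial] is not continuous. *)
pose g i (t : Delta n.+1) := F (y i (radial i t), 2 * (N * val t 0 i)).
pose mn (t : Delta n.+1) := [arg min_(i < ord0) val t 0 i]%O.
have mnP t : least t (mn t).
  by rewrite /mn; case: arg_minP => // i _ H j; exact: H.
have gE t i j : least t i -> least t j -> g i t = g j t.
  move=> ti tj; have tij : val t 0 i = val t 0 j by apply/eqP; rewrite eq_le ti tj.
  rewrite /g tij; have [t1|t1] := leP 1 (2 * (N * val t 0 j)); first by rewrite !F1.
  congr F; congr pair; apply: y_compat; apply: DeltaP => k.
  have t2 : N * val t 0 j < 1.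
    by have := mulr_ge0 (ler0n R n.+2) (simplex_ge0 t j); lra.
  by rewrite !radialE// tij.
have gc i (t : Delta n.+1) : N * val t 0 i != 1 -> {for t, continuous (g i)}.
  move=> t1.
  have cc k : continuous (fun t : Delta n.+1 => val t 0 k).
    exact: coord_simplex_continuous.
  have Nc : {for t, continuous (fun t : Delta n.+1 => N * val t 0 i)}.
    by apply: fun_mulr_continuous; [exact: cst_continuous|exact: cc].
  apply: (@continuous_comp2 _ _ _ _ (fun t => y i (radial i t))); last exact: Fc.
    apply: (@continuous_comp _ _ _ (radial i) (y i)); last exact: cts_fun.
    apply: (@continuous_comp _ _ _ (radial_row i) (@simplex_retr R n)); last first.
      exact: simplex_retr_continuous.
    apply: row_continuous => k.
    rewrite (_ : (fun _ => _) = (fun t : Delta n.+1 =>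
      (val t 0 (lift i k) - val t 0 i) / (1 - N * val t 0 i))); last first.
      by apply/funext => u; rewrite mxE.
    apply: fun_mulr_continuous; first by apply: fun_subr_continuous; exact: cc.
    apply: fun_invr_continuous; first by rewrite subr_eq0 eq_sym.
    by apply: fun_subr_continuous => //; exact: cst_continuous.
  by apply: fun_mulr_continuous => //; exact: cst_continuous.
pose s t := g (mn t) t.
have sc : continuous s.
  (* Away from the barycentre, a coordinate that is not least at t is not least nearby; the
     remaining finitely many [g i] are continuous at t and share one value there. At the barycentre
     the map is locally constant. *)
  move=> t; have [t1|t1] := ltP (N * val t 0 (mn t)) 1.
    move=> W Ws; suff : \forall u \near t, W (s u) by [].
    have : \forall u \near t, forall i, least u i -> W (g i u).
      apply: near_forall => i; have [ti|] := pselect (least t i).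
        have gci : {for t, continuous (g i)}.
          apply: gc; rewrite lt_eqF// (le_lt_trans _ t1)//.
          by rewrite ler_pM2l ?ltr0n //; exact: mnP.
        have Wg : nbhs (g i t) W by rewrite (gE t i (mn t)).
        by apply: filterS (continuous_near gci Wg).
      move=> /existsNP[j /negP]; rewrite -ltNge -subr_gt0 => tij.
      have dc : {for t, continuous (fun u : Delta n.+1 => val u 0 i - val u 0 j)}.
        by apply: fun_subr_continuous; exact: coord_simplex_continuous.
      apply: filterS (continuous_near dc (lt_nbhsr tij)) => u.
      by rewrite subr_gt0 => uij /(_ j); rewrite leNgt uij.
    by apply: filterS => u; exact.
  apply: (@near_continuous _ _ (fun=> x0)); last exact: cst_continuous.
  have : nbhs t [set u : Delta n.+1 | forall i, 1 / 2 < N * val u 0 i].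
    apply: (near_forall (P := fun i (u : Delta n.+1) => 1 / 2 < N * val u 0 i)) => i.
    have Nc : {for t, continuous (fun t : Delta n.+1 => N * val t 0 i)}.
      apply: fun_mulr_continuous; first exact: cst_continuous.
      exact: coord_simplex_continuous.
    have Nmn : N * val t 0 (mn t) <= N * val t 0 i by rewrite ler_pM2l ?ltr0n //; exact: mnP.
    have half : 1 / 2 < N * val t 0 i by move: t1 Nmn; lra.
    exact: (continuous_near Nc (lt_nbhsr half)).
  by apply: filterS => u /(_ (mn u)) u1; rewrite /s /g F1//; lra.
exists (to_simplex sc) => i t /=.
have ti0 : val (face_map i t) 0 i = 0 by rewrite /= mxE unlift_none.
have ti : least (face_map i t) i by move=> j; rewrite ti0 simplex_ge0.
rewrite /s (gE _ _ i)// /g ti0 mulr0 mulr0 F0//; apply: y_compat.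
by apply: DeltaP => k; rewrite radialE ?ti0 ?mulr0 ?ltr01// !subr0 divr1.
Qed.

End BoundaryFiller.

(** * Equivariant maps into contractible spaces *)

(** Pick one point in each orbit, taking b in its own orbit; by freeness k s is the unique element
    carrying the chosen point to s. The choice is made from the orbit as a set, so it is the same
    for all its points. No continuity is claimed. *)
Lemma orbit_coordinate (S G : Type) (one : G) (mul : G -> G -> G) (inv : G -> G)
    (act : S -> G -> S) (b : S) :
  (forall s, act s one = s) ->
  (forall s g h, act (act s g) h = act s (mul g h)) ->
  (forall g, mul g (inv g) = one) ->
  (forall s g h, act s g = act s h -> g = h) ->
  exists k : S -> G, (forall s g, k (act s g) = mul (k s) g) /\ k b = one.
Proof.
move=> act1 actM mulV free.
have /choice[pick pickP] (P : set S) : exists s, P !=set0 -> P s.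
  by have [[s Ps]|P0] := pselect (P !=set0); [exists s|exists b].
pose orb s := [set r | exists g, act r g = s].
pose rep s := if `[< orb s b >] then b else pick (orb s).
have repP s : orb s (rep s).
  by rewrite /rep; case: asboolP => // _; apply: pickP; exists s; exists one.
have orbE s g : orb (act s g) = orb s.
  apply/seteqP; split=> r [h rh].
    by exists (mul h (inv g)); rewrite -actM rh actM mulV act1.
  by exists (mul h g); rewrite -actM rh.
have [k kP] := choice repP; exists k; split=> [s g|].
  have repE : rep (act s g) = rep s by rewrite /rep orbE.
  by apply: (free (rep s)); rewrite -actM kP -repE kP.
have orbb : orb b b by exists one.
by apply: (free b); rewrite act1 -[RHS](kP b) /rep asboolT.
Qed.

Section Faces.
Context (R : realType).

Local Notation Delta n := (@standard_simplex R n).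
Local Notation Sing := (singular_simplex R).

Definition face (X : topologicalType) (n : nat) (i : 'I_n.+2) (s : Sing X n.+1) :
    Sing X n := s \o face_map i.

Lemma face_map_inj n (i : 'I_n.+2) : injective (@face_map R n i).
Proof.
move=> t u tu; apply: DeltaP => k.
have := congr1 (fun v : Delta n.+1 => val v 0 (lift i k)) tu.
by rewrite /= !mxE !liftK.
Qed.

(** The hypotheses say that j' is the position of j once i is removed, and i' that of i once j is
    removed. This symmetric form of the simplicial identity needs no case distinction on i < j. *)
Lemma lift_swap n (i j : 'I_n.+3) (i' j' : 'I_n.+2) (k : 'I_n.+1) :
  lift i j' = j -> lift j i' = i -> lift i (lift j' k) = lift j (lift i' k).
Proof.
move=> /(congr1 val) ij /(congr1 val) ji; apply: val_inj; move: ij ji.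
rewrite /= /bump; lia.
Qed.

Lemma face_face X n (i j : 'I_n.+3) (i' j' : 'I_n.+2) (s : Sing X n.+2) :
  lift i j' = j -> lift j i' = i -> face j' (face i s) = face i' (face j s).
Proof.
move=> ij ji; apply: simplexP => t; rewrite /face /= !face_mapE !push_comp.
by congr (s _); apply: eq_push => k /=; exact: lift_swap.
Qed.

Lemma face_map_eq0 (i j : 'I_2) (t u : Delta 0) :
  face_map i t = face_map j u -> i = j.
Proof.
move=> tu; apply/eqP; case: (eqVneq i j) => // ij; have [k jk] := unlift_some ij.
have := congr1 (fun v : Delta 1 => val v 0 j) tu.
rewrite /= !mxE unlift_none; case: unliftP => [l _|ji]; last first.
  by rewrite ji eqxx in ij.
move=> t0; have := simplex_sum t; rewrite big_ord1 (ord1 l) in t0 *.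
by rewrite t0 => /esym/eqP; rewrite oner_eq0.
Qed.

(** Two distinct facets meet in a face of codimension 2, so agreement of prescribed values on facets
    can be checked there by the simplicial identity. *)
Lemma face_map_eqS n (i j : 'I_n.+3) (t u : Delta n.+1) :
  i != j -> face_map i t = face_map j u ->
  exists i' j' w, [/\ lift i j' = j, lift j i' = i, t = face_map j' w & u = face_map i' w].
Proof.
move=> ij tu; have [j' jE _] := unlift_some ij.
have ji : j != i by rewrite eq_sym.
have [i' iE _] := unlift_some ji.
have tj' : val t 0 j' = 0.
  have := congr1 (fun v : Delta n.+2 => val v 0 j) tu.
  by rewrite /= !mxE unlift_none jE liftK.
pose w := \row_k val t 0 (lift j' k) : 'rV[R]_n.+1.
have wD : Delta n w.
  split=> [k|]; first by rewrite mxE simplex_ge0.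
  under eq_bigr do rewrite mxE.
  by rewrite -(simplex_sum t) (bigD1_ord j')//= tj' add0r.
pose W : Delta n := exist _ w (mem_set wD).
have tE : t = face_map j' W.
  apply: DeltaP => k; rewrite /= mxE; case: unliftP => [l ->|->//].
  by rewrite mxE.
exists i', j', W; split=> //; apply: (@face_map_inj _ j); rewrite -tu tE.
rewrite !face_mapE !push_comp; apply: eq_push => k /=.
exact: lift_swap.
Qed.

End Faces.

Section SimplexGroup.
Context (R : realType) (H : topologicalGroupType) (n : nat).
Local Notation Sing := (singular_simplex R).
Implicit Types g h : Sing H n.

Lemma simplex_mul_continuous g h : continuous (fun t => (g t * h t)%g).
Proof.
move=> t; apply: (@continuous_comp2 _ _ _ _ g h (fun z : H * H => (z.1 * z.2)%g)).
- exact: cts_fun.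
- exact: cts_fun.
- exact: mulg_continuous.
Qed.

Definition simplex_mul g h : Sing H n := to_simplex (@simplex_mul_continuous g h).

Lemma simplex_inv_continuous g : continuous (fun t => ((g t)^-1)%g).
Proof.
move=> t; apply: (@continuous_comp _ _ _ g (fun x : H => (x^-1)%g)).
  exact: cts_fun.
exact: invg_continuous.
Qed.

Definition simplex_inv g : Sing H n := to_simplex (@simplex_inv_continuous g).

Definition simplex_one : Sing H n := const_simplex R n (1%g : H).

Lemma simplex_mulV g : simplex_mul g (simplex_inv g) = simplex_one.
Proof. by apply: simplexP => t; exact: mulgV. Qed.

Context (E : topologicalType) (rho : E -> H -> E).
Hypothesis rho_continuous : continuous (fun z : E * H => rho z.1 z.2).

Lemma simplex_act_continuous (a : Sing E n) h : continuous (fun t => rho (a t) (h t)).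
Proof.
move=> t; apply: (@continuous_comp2 _ _ _ _ a h (fun z => rho z.1 z.2)).
- exact: cts_fun.
- exact: cts_fun.
- exact: rho_continuous.
Qed.

Definition simplex_act (a : Sing E n) h : Sing E n :=
  to_simplex (@simplex_act_continuous a h).

End SimplexGroup.

Section EquivariantExtension.
Context (R : realType) (H : topologicalGroupType).
Local Notation Sing := (singular_simplex R).

(** The source is an abstract free object because it has two instances: Sing(EH), and the simplices
    of EK with a label in H at each vertex. *)
Context (S : nat -> Type) (d : forall n, 'I_n.+2 -> S n.+1 -> S n).
Context (act : forall n, S n -> Sing H n -> S n) (b : forall n, S n).
Hypothesis d_d : forall n (i j : 'I_n.+3) (i' j' : 'I_n.+2) (s : S n.+2),
  lift i j' = j -> lift j i' = i -> d j' (d i s) = d i' (d j s).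
Hypothesis d_act : forall n (i : 'I_n.+2) (s : S n.+1) h,
  d i (act s h) = act (d i s) (face i h).
Hypothesis act1 : forall n (s : S n), act s (simplex_one R H n) = s.
Hypothesis actM : forall n (s : S n) g h, act (act s g) h = act s (simplex_mul g h).
Hypothesis act_free : forall n (s : S n) g h, act s g = act s h -> g = h.
Hypothesis d_b : forall n (i : 'I_n.+2), d i (b n.+1) = b n.

Context (E : topologicalType) (Ec : contractible R E) (e : E) (rho : E -> H -> E).
Hypothesis rho_continuous : continuous (fun z : E * H => rho z.1 z.2).
Hypothesis rho1 : forall x, rho x 1%g = x.
Hypothesis rhoM : forall x g h, rho x (g * h)%g = rho (rho x g) h.

Local Notation ract := (simplex_act rho_continuous).

(* Simplices of the free object are sent to the contractible space by induction
   on the dimension, orbit by orbit. *)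
Lemma equivariant_extension : exists f : forall n, S n -> Sing E n,
  [/\ forall n (i : 'I_n.+2) s, f n (d i s) = face i (f n.+1 s),
      forall n s h, f n (act s h) = ract (f n s) h &
      forall n, f n (b n) = const_simplex R n e].
Proof.
have k_ex n : exists k : S n -> Sing H n,
    (forall s g, k (act s g) = simplex_mul (k s) g) /\ k (b n) = simplex_one R H n.
  apply: (@orbit_coordinate _ _ _ _ (@simplex_inv R H n)) => //.
  - by move=> g; exact: simplex_mulV.
  - exact: act_free.
pose k n := projT1 (cid (k_ex n)).
have [kM kb] := all_and2 (fun n => projT2 (cid (k_ex n)) :
  (forall s g, k n (act s g) = simplex_mul (k n s) g) /\ k n (b n) = simplex_one R H n).
pose compat n (y : 'I_n.+2 -> Sing E n) :=
  forall i j t u, face_map i t = face_map j u -> y i t = y j u.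
(* The second clause makes the filling of a constant boundary constant, which [boundary_filler] does
   not promise; it forces the base simplices [b n] to go to constant ones. *)
have fill_ex (n : nat) (y : 'I_n.+2 -> Sing E n) : exists s : Sing E n.+1,
    (compat n y -> forall i, face i s = y i) /\
    ((forall i, y i = const_simplex R n e) -> s = const_simplex R n.+1 e).
  have [yb|nyb] := pselect (forall i, y i = const_simplex R n e).
    exists (const_simplex R n.+1 e); split=> // _ i.
    by rewrite yb; apply: simplexP.
  have [yc|nyc] := pselect (compat n y); last first.
    by exists (const_simplex R n.+1 e).
  have [s sP] := boundary_filler Ec yc.
  by exists s; split=> // _ i; apply: simplexP => t; exact: sP.
pose fill n y := projT1 (cid (fill_ex n y)).
have fillP n y : (compat n y -> forall i, face i (fill n y) = y i) /\
    ((forall i, y i = const_simplex R n e) -> fill n y = const_simplex R n.+1 e).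
  exact: (projT2 (cid (fill_ex n y))).
(* [red s] is the representative of the orbit of s. Its image is found by filling the boundary and
   is then translated by [k s]; in dimension 0 every representative goes to e. *)
pose red n (s : S n) := act s (simplex_inv (k n s)).
pose F := fix F n : S n -> Sing E n :=
  match n return S n -> Sing E n with
  | 0 => fun s => ract (const_simplex R 0 e) (k 0 s)
  | m.+1 => fun s => ract (fill m (fun i => F m (d i (red _ s)))) (k m.+1 s)
  end.
have redK n s : act (red n s) (k n s) = s.
  rewrite /red actM (_ : simplex_mul _ _ = simplex_one R H n) ?act1//.
  by apply: simplexP => t; exact: mulVg.
have red_act n s h : red n (act s h) = red n s.
  rewrite /red actM kM; congr act; apply: simplexP => t.
  by rewrite /= invgM mulVKg.
have FM n s h : F n (act s h) = ract (F n s) h.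
  case: n s h => [|n] s h /=.
    by rewrite kM; apply: simplexP => t; exact: rhoM.
  by rewrite red_act kM; apply: simplexP => t; exact: rhoM.
have redb n : red n (b n) = b n.
  rewrite /red kb (_ : simplex_inv _ = simplex_one R H n) ?act1//.
  by apply: simplexP => t; exact: invg1.
have Fb n : F n (b n) = const_simplex R n e.
  elim: n => [|n IHn] /=; first by rewrite kb; apply: simplexP => t; exact: rho1.
  rewrite redb kb (fillP n _).2; last by move=> i; rewrite d_b.
  by apply: simplexP => t; exact: rho1.
exists F; split=> //; elim=> [|n IHn] i s.
- have y_compat : compat 0%N (fun i => F 0%N (d i (red 1%N s))).
    move=> j l t u tu; have jl := face_map_eq0 tu; rewrite -jl in tu *.
    by rewrite (face_map_inj tu).
  transitivity (ract (face i (fill 0%N (fun i => F 0%N (d i (red 1%N s)))))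
    (face i (k 1%N s))); last exact: simplexP.
  by rewrite (fillP 0%N _).1// -FM -d_act redK.
- have y_compat : compat n.+1 (fun i => F n.+1 (d i (red n.+2 s))).
    move=> j l t u tu; case: (eqVneq j l) => [jl|jl].
      by rewrite -jl in tu *; rewrite (face_map_inj tu).
    have [j' [l' [w [jl' lj' -> ->]]]] := face_map_eqS jl tu.
    transitivity (face l' (F n.+1 (d j (red n.+2 s))) w) => //.
    transitivity (face j' (F n.+1 (d l (red n.+2 s))) w) => //.
    by rewrite -!IHn (d_d _ jl' lj').
  (* Faces of a representative need not be representatives; equivariance one dimension lower makes
     up for this. *)
  transitivity (ract (face i (fill n.+1 (fun i => F n.+1 (d i (red n.+2 s)))))
    (face i (k n.+2 s))); last exact: simplexP.
  by rewrite (fillP n.+1 _).1// -FM -d_act redK.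
Qed.

End EquivariantExtension.

(** * Lifting of simplices *)

Section BoxLift.
Context (R : realType) (m : nat) (E B : topologicalType) (pi : E -> B).
Local Notation V := 'rV[R]_m.

Hypothesis local_section : forall b, exists U (s : B -> E),
  [/\ open U, U b & forall c, U c -> {for c, continuous s} /\ pi (s c) = c].
(** Here r will be a retraction onto the wall between two boxes: a lift on one side can be moved
    within fibres until it matches the other lift on the wall. For Borel constructions the move is a
    translation by H, for finite coverings a deck transformation. *)
Hypothesis lift_modification : forall (s1 s2 : V -> E) (r : V -> V),
  continuous s1 -> continuous s2 -> continuous r ->
  (forall t, pi (s1 (r t)) = pi (s2 (r t))) ->
  exists s : V -> E, [/\ continuous s, forall t, pi (s t) = pi (s2 t) &
    forall t, r t = t -> s t = s1 t].

Context (tau : V -> B) (tau_continuous : continuous tau).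

Implicit Types (a b t : V).

Let le_row a b := forall i, a 0 i <= b 0 i.

Definition clamp_row a b t : V :=
  \row_i Num.max (a 0 i) (Num.min (b 0 i) (t 0 i)).

Let clampE a b t i :
  clamp_row a b t 0 i = Num.max (a 0 i) (Num.min (b 0 i) (t 0 i)).
Proof. by rewrite mxE. Qed.

Lemma clamp_row_continuous a b : continuous (clamp_row a b).
Proof.
move=> t; apply: row_continuous => i.
rewrite (_ : (fun _ => _) = (fun t : V => Num.max (a 0 i) (Num.min (b 0 i) (t 0 i)))).
  apply: fun_maxr_continuous; first exact: cst_continuous.
  by apply: fun_minr_continuous; [exact: cst_continuous|exact: coord_continuous].
by apply/funext => u; rewrite clampE.
Qed.

Lemma clamp_row_id a b t : le_row a t -> le_row t b -> clamp_row a b t = t.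
Proof. by move=> at_ tb; apply/rowP => i; rewrite clampE min_r// max_r. Qed.

Let clamp_ge a b t : le_row a (clamp_row a b t).
Proof. by move=> i; rewrite clampE le_max lexx. Qed.

Let clamp_le a b t : le_row a b -> le_row (clamp_row a b t) b.
Proof. by move=> ab i; rewrite clampE ge_max ab ge_min lexx. Qed.

(** Liftability over the box between a and b, stated through the projection onto the box so that
    every map is defined on the whole space of rows. *)
Let good a b := exists s : V -> E,
  continuous s /\ forall t, pi (s t) = tau (clamp_row a b t).

Let upd (v : V) (i : 'I_m) (c : R) : V := \row_j if j == i then c else v 0 j.

Let updE v i c j : upd v i c 0 j = if j == i then c else v 0 j.
Proof. by rewrite mxE. Qed.

(** The halves share the wall where coordinate i equals c. The second lift is modified to agree with
    the first on it, and the two are pasted. *)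
Let good_split a b i c : le_row a b -> a 0 i <= c <= b 0 i ->
  good a (upd b i c) -> good (upd a i c) b -> good a b.
Proof.
move=> ab /andP[ac cb] [s1 [s1c s1P]] [s2 [s2c s2P]].
pose r := clamp_row (upd a i c) (upd b i c).
have ab1 : le_row a (upd b i c) by move=> j; rewrite updE; case: eqP => // ->.
have ab2 : le_row (upd a i c) b by move=> j; rewrite updE; case: eqP => // ->.
have abr : le_row (upd a i c) (upd b i c).
  by move=> j; rewrite !updE; case: eqP.
have r1 t : clamp_row a (upd b i c) (r t) = r t.
  apply: clamp_row_id; last exact: clamp_le.
  move=> j; apply: le_trans (clamp_ge _ _ _ _); rewrite updE.
  by case: eqP => // ->.
have r2 t : clamp_row (upd a i c) b (r t) = r t.
  apply: clamp_row_id; first exact: clamp_ge.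
  move=> j; apply: (le_trans (clamp_le _ abr j)); rewrite updE.
  by case: eqP => // ->.
have [s [sc sP sr]] : exists s : V -> E, [/\ continuous s,
    forall t, pi (s t) = pi (s2 t) & forall t, r t = t -> s t = s1 t].
  apply: lift_modification => //; first exact: clamp_row_continuous.
  by move=> t; rewrite s1P s2P r1 r2.
pose cl1 := clamp_row a (upd b i c); pose cl2 := clamp_row (upd a i c) b.
exists (fun t => if t 0 i - c <= 0 then s1 (cl1 t) else s (cl2 t)); split.
  apply: (@glue_continuous R V E (fun t => t 0 i - c) (s1 \o cl1) (s \o cl2)).
  - move=> t; apply: fun_subr_continuous; last exact: cst_continuous.
    exact: coord_continuous.
  - move=> t; apply: continuous_comp; last exact: s1c.
    exact: clamp_row_continuous.
  - move=> t; apply: continuous_comp; last exact: sc.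
    exact: clamp_row_continuous.
  move=> t /subr0_eq tc /=.
  have -> : cl1 t = r t.
    apply/rowP => j; rewrite !clampE !updE; case: eqP => // ->.
    by rewrite tc minxx maxxx max_r.
  have -> : cl2 t = r t.
    apply/rowP => j; rewrite !clampE !updE; case: eqP => // ->.
    by rewrite tc minxx maxxx min_r// maxxx.
  rewrite sr//; apply: clamp_row_id; [exact: clamp_ge|exact: clamp_le].
move=> t; rewrite subr_le0; case: leP => tc.
  rewrite s1P; congr tau; rewrite clamp_row_id; [|exact: clamp_ge|exact: clamp_le].
  apply/rowP => j; rewrite !clampE !updE; case: eqP => // ->.
  by rewrite !min_r// (le_trans tc).
rewrite sP s2P; congr tau; rewrite clamp_row_id; [|exact: clamp_ge|exact: clamp_le].
apply/rowP => j; rewrite !clampE !updE; case: eqP => // ->.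
have ct : c <= Num.min (b 0 i) (t 0 i) by rewrite le_min cb ltW.
by rewrite !max_r// (le_trans ac).
Qed.

Let unit_box : set V := [set v | forall i, `[0, 1]%classic (v 0 i)].

Let good_below dl := forall a b, le_row a b -> unit_box a -> unit_box b ->
  (forall i, b 0 i - a 0 i < dl) -> good a b.

(** A Lebesgue number: by compactness of the unit box, one dl works for all small boxes, each being
    sent by [tau] into an open set with a section. *)
Let good_small : exists2 dl : R, 0 < dl & good_below dl.
Proof.
have box_cpt : compact unit_box.
  by apply: (@rV_compact R m (fun=> `[0, 1]%classic)) => i; exact: segment_compact.
pose P (dl : R) (x : V) := forall a b, le_row a b -> ball x dl a -> ball x dl b ->
  good a b.
have : \forall dl \near 0^'+, unit_box `<=` P dl.
  apply: (compact_near_coveringP _).1 => // x _.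
  have [U [s [oU Ux sP]]] := local_section (tau x).
  have : nbhs x (tau @^-1` U).
    by apply: tau_continuous; apply: open_nbhs_nbhs.
  move=> /nbhs_ballP[r /= r0 rU].
  exists (ball x (r / 2), [set dl : R | dl < r / 2]).
    split => /=; first by apply: nbhsx_ballx; rewrite divr_gt0.
    by apply: nbhs_right_lt; rewrite divr_gt0.
  move=> [x' dl] /= [xx' dlr] a b ab xa xb.
  have Ut t : U (tau (clamp_row a b t)).
    apply: rU; apply: (@ball_splitr _ _ x') => //=; first exact: ball_sym.
    split; first by rewrite divr_gt0.
    move=> i j; rewrite (ord1 i).
    have := clamp_ge a b t j; have := clamp_le t ab j.
    have := xa.2 0 j; have := xb.2 0 j; rewrite /ball /= !ltr_norml.
    by move=> /andP[? ?] /andP[? ?] ? ?; apply/andP; split; lra.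
  exists (fun t => s (tau (clamp_row a b t))); split=> [t|t].
    apply: (@continuous_comp _ _ _ (tau \o clamp_row a b) s).
      apply: continuous_comp; last exact: tau_continuous.
      exact: clamp_row_continuous.
    exact: (sP _ (Ut t)).1.
  exact: (sP _ (Ut t)).2.
move=> near_P; have [dl [dl0 dlP]] := filter_ex (filterI (nbhs_right_gt 0) near_P).
exists dl => // a b ab abox _ abdl; apply: (dlP a) => //; first exact: ballxx.
split=> // i j; rewrite (ord1 i) /ball /= distrC ger0_norm ?subr_ge0//.
Qed.

Let good_double dl : good_below dl -> good_below (2 * dl).
Proof.
move=> gdl.
(* Coordinates are halved one at a time: only those below l may still have a side of up to 2 *
   dl. *)
suff H l a b : le_row a b -> unit_box a -> unit_box b ->
    (forall i, b 0 i - a 0 i < 2 * dl) ->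
    (forall i : 'I_m, (l <= i)%N -> b 0 i - a 0 i < dl) -> good a b.
  move=> a b ab ua ub abdl; apply: (H m) => // i.
  by rewrite leqNgt ltn_ord.
elim: l a b => [|l IHl] a b ab ua ub ab2 ab1; first by apply: gdl => // i; exact: ab1.
have [lm|ml] := ltnP l m; last first.
  by apply: IHl => // i li; have := ltn_ord i; rewrite ltnNge (leq_trans ml).
pose i := Ordinal lm; pose c := (a 0 i + b 0 i) / 2.
have aibi := ab i; have ab2i := ab2 i.
have [ua0 ua1] : 0 <= a 0 i /\ a 0 i <= 1 by have := ua i; rewrite /= in_itv/= => /andP.
have [ub0 ub1] : 0 <= b 0 i /\ b 0 i <= 1 by have := ub i; rewrite /= in_itv/= => /andP.
apply: (@good_split a b i c) => //; first by rewrite /c; apply/andP; split; lra.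
  apply: IHl => //.
  - by move=> j; rewrite updE; case: eqP => // ->; rewrite /c; lra.
  - move=> j; rewrite updE; case: eqP => [_|_]; last exact: ub.
    by rewrite /= in_itv/= /c; apply/andP; split; lra.
  - move=> j; rewrite updE; case: eqP => [->|_]; last exact: ab2.
    by rewrite /c; lra.
  - move=> j lj; rewrite updE; case: eqP => [->|/eqP ji]; first by rewrite /c; lra.
    by apply: ab1; rewrite ltn_neqAle lj andbT eq_sym.
apply: IHl => //.
- by move=> j; rewrite updE; case: eqP => // ->; rewrite /c; lra.
- move=> j; rewrite updE; case: eqP => [_|_]; last exact: ua.
  by rewrite /= in_itv/= /c; apply/andP; split; lra.
- move=> j; rewrite updE; case: eqP => [->|_]; last exact: ab2.
  by rewrite /c; lra.
- move=> j lj; rewrite updE; case: eqP => [->|/eqP ji]; first by rewrite /c; lra.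
  by apply: ab1; rewrite ltn_neqAle lj andbT eq_sym.
Qed.

Lemma box_lift : exists s : V -> E, continuous s /\
  forall t, (forall i, 0 <= t 0 i <= 1) -> pi (s t) = tau t.
Proof.
have [dl dl0 gdl] := good_small.
have gpow k : good_below (2 ^+ k * dl).
  elim: k => [|k IHk]; first by rewrite expr0 mul1r.
  by rewrite exprS -mulrA; exact: good_double.
have [k kP] : exists k : nat, 1 < 2 ^+ k * dl.
  have [k kP] : exists k : nat, dl^-1 < k%:R.
    by exists (Num.truncn dl^-1).+1; exact: truncnS_gt.
  exists k; rewrite -ltr_pdivrMr// div1r (lt_le_trans kP)// -natrX ler_nat.
  by rewrite ltnW// ltn_expl.
have [||||s [sc sP]] := gpow k (const_mx 0) (const_mx 1).
- by move=> i; rewrite !mxE.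
- by move=> i; rewrite mxE /= in_itv/= lexx ler01.
- by move=> i; rewrite mxE /= in_itv/= lexx ler01.
- by move=> i; rewrite !mxE subr0.
exists s; split=> // t t01; rewrite sP clamp_row_id// => i; rewrite mxE;
  by have /andP[] := t01 i.
Qed.

End BoxLift.

Section SimplexLift.
Context (R : realType) (n : nat) (E B : topologicalType) (pi : E -> B).
Local Notation V := 'rV[R]_n.+1.

(** The retraction extends [tau] to all rows, and the simplex lies in the unit cube, where
    [box_lift] applies. *)
Lemma simplex_lift (tau : singular_simplex R B n) :
  (forall b, exists U (s : B -> E),
    [/\ open U, U b & forall c, U c -> {for c, continuous s} /\ pi (s c) = c]) ->
  (forall (s1 s2 : V -> E) (r : V -> V),
    continuous s1 -> continuous s2 -> continuous r ->
    (forall t, pi (s1 (r t)) = pi (s2 (r t))) ->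
    exists s : V -> E, [/\ continuous s, forall t, pi (s t) = pi (s2 t) &
      forall t, r t = t -> s t = s1 t]) ->
  exists s : singular_simplex R E n, forall t, pi (s t) = tau t.
Proof.
move=> sect modif; have tc : continuous (tau \o @simplex_retr R n).
  move=> t; apply: continuous_comp; first exact: simplex_retr_continuous.
  exact: cts_fun.
have [s [sc sP]] := box_lift sect modif tc.
have svc : continuous (fun t : @standard_simplex R n => s (val t)).
  move=> t; apply: (@continuous_comp _ _ _
    (fun t : @standard_simplex R n => val t) s); last exact: sc.
  exact: val_continuous.
exists (to_simplex svc) => t /=; rewrite sP /= ?simplex_retrK// => i.
rewrite simplex_ge0 -[leRHS](simplex_sum t) (bigD1 i)//= lerDl sumr_ge0// => j _.
exact: simplex_ge0.
Qed.

End SimplexLift.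

(** * Principal bundles and the singular simplices of Borel constructions *)

Section PrincipalBundle.
Context (H : topologicalGroupType) (P : principal_bundle H).
Local Notation E := (total_space P).
Implicit Types (e : E) (h : H).

Lemma bundle_proj_ract e h : bundle_proj (ract e h) = bundle_proj e.
Proof.
have [U [triv [coord [oU Ue tr]]]] := bundle_locally_trivial (bundle_proj e).
by rewrite -[in LHS](coordK tr Ue) -(triv_act tr)// (triv_proj tr).
Qed.

Lemma coord_ract U triv coord :
  local_trivialization (@bundle_proj _ P) (@ract _ P) U triv coord ->
  forall e h, U (bundle_proj e) -> coord (ract e h) = (coord e * h)%g.
Proof.
move=> tr e h Ue.
by rewrite -[in LHS](coordK tr Ue) -(triv_act tr)// (triv_coord tr).
Qed.

Lemma ract_inj e h h' : ract e h = ract e h' -> h = h'.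
Proof.
have [U [triv [coord [oU Ue tr]]]] := bundle_locally_trivial (bundle_proj e).
by move=> /(congr1 coord); rewrite !(coord_ract tr)//; exact: mulgI.
Qed.

Lemma ract_transitive e e' : bundle_proj e = bundle_proj e' ->
  exists h, ract e' h = e.
Proof.
have [U [triv [coord [oU Ue tr]]]] := bundle_locally_trivial (bundle_proj e).
move=> ee'; exists ((coord e')^-1 * coord e)%g.
have Ue' : U (bundle_proj e') by rewrite -ee'.
by rewrite -{1}(coordK tr Ue') -(triv_act tr)// mulVKg -ee' (coordK tr).
Qed.

(** In a local trivialization the translation is the quotient of the two H-coordinates, hence
    continuous. *)
Lemma bundle_translation (T : topologicalType) (s1 s2 : T -> E) :
  continuous s1 -> continuous s2 ->
  (forall t, bundle_proj (s1 t) = bundle_proj (s2 t)) ->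
  exists h : T -> H, continuous h /\ forall t, ract (s2 t) (h t) = s1 t.
Proof.
move=> s1c s2c s12.
have /choice[h hP] t : exists h, ract (s2 t) h = s1 t by exact: ract_transitive.
exists h; split=> // t.
have [U [triv [coord [oU Us tr]]]] := bundle_locally_trivial (bundle_proj (s2 t)).
have Usn : \forall u \near t, U (bundle_proj (s2 u)).
  have pc : {for t, continuous (fun u => bundle_proj (s2 u))}.
    by apply: (@continuous_comp _ _ _ s2); [exact: s2c|exact: bundle_proj_continuous].
  by apply: (continuous_near pc); exact: open_nbhs_nbhs.
apply: (@near_continuous _ _ (fun u => ((coord (s2 u))^-1 * coord (s1 u))%g)).
  by apply: filterS Usn => u Uu; rewrite -hP (coord_ract tr)// mulKg.
have cc (s : T -> E) : continuous s -> U (bundle_proj (s t)) ->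
    {for t, continuous (fun u => coord (s u))}.
  move=> sc Ust; apply: (@continuous_comp _ _ _ s coord); first exact: sc.
  exact: (trivialization_coord_continuous tr).
apply: (@continuous_comp2 _ _ _ _ _ _ (fun z : H * H => (z.1 * z.2)%g)).
- apply: (@continuous_comp _ _ _ (fun u => coord (s2 u)) (fun x : H => (x^-1)%g)).
    exact: cc.
  exact: invg_continuous.
- by apply: cc => //; rewrite s12.
- exact: mulg_continuous.
Qed.

Context (X : topologicalType) (a : left_action H X).
Local Notation Q := (homotopy_quotient P a).

Definition borel_pi (z : E * X) : Q := \pi_Q z.

Lemma borel_piP z w : borel_pi z = borel_pi w <->
  exists h, z.1 = ract w.1 h /\ w.2 = a h z.2.
Proof.
split=> [/eqmodP/asboolP//|zw].
by apply/eqmodP/asboolP.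
Qed.

Lemma borel_pi_continuous : continuous borel_pi.
Proof. exact: pi_continuous. Qed.

Lemma borel_piK (q : Q) : borel_pi (repr q) = q.
Proof. exact: reprK. Qed.

Lemma borel_pi_act e h x : borel_pi (ract e h, x) = borel_pi (e, a h x).
Proof. by apply/borel_piP; exists h. Qed.

Lemma left_action_continuous (T : topologicalType) (h : T -> H) (x : T -> X) t :
  {for t, continuous h} -> {for t, continuous x} ->
  {for t, continuous (fun u => a (h u) (x u))}.
Proof.
move=> hc xc; apply: (@continuous_comp2 _ _ _ _ h x (fun z => a z.1 z.2)) => //.
exact: lact_continuous.
Qed.

(** Over a trivializing open set each class has a normal form: the first component is moved to
    H-coordinate 1 and the old coordinate acts on the second. This is constant on classes, so it
    descends to a continuous section. *)
Lemma borel_local_section (q : Q) : exists U (s : Q -> E * X),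
  [/\ open U, U q & forall c, U c -> {for c, continuous s} /\ borel_pi (s c) = c].
Proof.
pose e := (repr q).1.
have [U [triv [coord [oU Ue tr]]]] := bundle_locally_trivial (bundle_proj e).
pose g (z : E * X) : E * X := (triv (bundle_proj z.1, 1%g), a (coord z.1) z.2).
have gU z w : borel_pi z = borel_pi w -> U (bundle_proj z.1) ->
    U (bundle_proj w.1) /\ g z = g w.
  move=> /borel_piP[h [zw wz]]; rewrite zw bundle_proj_ract => Uw; split=> //.
  by rewrite /g zw bundle_proj_ract (coord_ract tr)// lactM wz.
have gpi z : U (bundle_proj z.1) -> borel_pi (g z) = borel_pi z.
  move=> Uz; rewrite /g -borel_pi_act -(triv_act tr)// mul1g (coordK tr)//.
  by case: z {Uz}.
have gc z : U (bundle_proj z.1) -> {for z, continuous g}.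
  move=> Uz; apply: pair_continuous.
    apply: (@continuous_comp _ _ _ (fun z : E * X => (bundle_proj z.1, 1%g : H)) triv).
      apply: pair_continuous; last exact: cst_continuous.
      apply: (@continuous_comp _ _ _ fst); first exact: cvg_fst.
      exact: bundle_proj_continuous.
    exact: (triv_continuous tr).
  apply: left_action_continuous; last exact: cvg_snd.
  apply: (@continuous_comp _ _ _ fst coord); first exact: cvg_fst.
  exact: (trivialization_coord_continuous tr).
pose W : set Q := [set c | U (bundle_proj (repr c).1)].
have WP z : W (borel_pi z) <-> U (bundle_proj z.1).
  split=> Uz; first exact: (gU _ _ (borel_piK (borel_pi z)) Uz).1.
  exact: (gU _ _ (esym (borel_piK (borel_pi z))) Uz).1.
have preW : borel_pi @^-1` W = [set z | U (bundle_proj z.1)].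
  by apply/seteqP; split=> z /WP.
have oUz : open [set z : E * X | U (bundle_proj z.1)].
  apply: (@open_comp _ _ (fun z : E * X => bundle_proj z.1) U) => // z _.
  apply: (@continuous_comp _ _ _ fst); first exact: cvg_fst.
  exact: bundle_proj_continuous.
exists W, (g \o repr); split=> [||c Wc].
- by rewrite /open/= /quotient_open preW.
- exact: Ue.
- split; last by rewrite gpi ?borel_piK.
  move=> D; rewrite /= nbhsE => -[A [oA Ac] AD].
  suff : nbhs c (W `&` [set d | A (g (repr d))]).
    by apply: filterS => d [_ /AD].
  apply: open_nbhs_nbhs; split=> //.
  rewrite /open/= /quotient_open.
  rewrite (_ : _ @^-1` _ = [set z | U (bundle_proj z.1)] `&` g @^-1` A).
    rewrite openE => z [Uz Az]; apply: filterI; first exact: open_nbhs_nbhs.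
    by apply: (gc z Uz); exact: open_nbhs_nbhs.
  apply/seteqP; split=> z.
    move=> [/WP Uz /=]; rewrite (gU _ _ (esym (borel_piK (borel_pi z))) Uz).2.
    by split.
  move=> [Uz Az]; split; first exact/WP.
  by rewrite /= -(gU _ _ (esym (borel_piK (borel_pi z))) Uz).2.
Qed.

Context (R : realType).
Local Notation Sing := (singular_simplex R).

Lemma borel_simplex_continuous n (s : Sing E n) (x : Sing X n) :
  continuous (fun t => borel_pi (s t, x t)).
Proof.
move=> t; apply: (@continuous_comp _ _ _ (fun t => (s t, x t))).
  by apply: pair_continuous; exact: cts_fun.
exact: borel_pi_continuous.
Qed.

Definition borel_simplex n (s : Sing E n) (x : Sing X n) : Sing Q n :=
  to_simplex (@borel_simplex_continuous n s x).

Lemma borel_simplex_lift n (tau : Sing Q n) :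
  exists s x, tau = borel_simplex s x.
Proof.
have [s sP] : exists s : Sing (E * X)%type n, forall t, borel_pi (s t) = tau t.
  apply: simplex_lift; first exact: borel_local_section.
  move=> s1 s2 r s1c s2c rc s12.
  (* The translation is measured at [r t] but applied at t: [s2] moves along its orbits everywhere
     and becomes [s1] at the fixed points of r. *)
  have [h [hc hP]] : exists h : 'rV[R]_n.+1 -> H, continuous h /\
      forall t, ract (s2 (r t)).1 (h t) = (s1 (r t)).1.
    have c1 (s : 'rV[R]_n.+1 -> E * X) : continuous s ->
        continuous (fun t => (s (r t)).1).
      move=> sc t; apply: (@continuous_comp _ _ _ (s \o r) fst); last exact: cvg_fst.
      by apply: continuous_comp; [exact: rc|exact: sc].
    apply: bundle_translation; [exact: c1|exact: c1|] => t.
    by have [h [-> _]] := (borel_piP _ _).1 (s12 t); rewrite bundle_proj_ract.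
  exists (fun t => (ract (s2 t).1 (h t), a ((h t)^-1)%g (s2 t).2)); split.
  - move=> t; have f1 : {for t, continuous (fun t : 'rV[R]_n.+1 => (s2 t).1)}.
      by apply: (@continuous_comp _ _ _ s2 fst); [exact: s2c|exact: cvg_fst].
    have f2 : {for t, continuous (fun t : 'rV[R]_n.+1 => (s2 t).2)}.
      by apply: (@continuous_comp _ _ _ s2 snd); [exact: s2c|exact: cvg_snd].
    apply: (@pair_continuous 'rV[R]_n.+1 E X).
      apply: (@continuous_comp2 _ _ _ _ _ _ (fun z : E * H => ract z.1 z.2)) => //.
        exact: hc.
      exact: ract_continuous.
    apply: left_action_continuous => //.
    apply: (@continuous_comp _ _ _ h (fun x : H => (x^-1)%g)); first exact: hc.
    exact: invg_continuous.
  - move=> t; rewrite borel_pi_act -lactM mulgV lact1.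
    by case: (s2 t).
  - move=> t rt; have [k [s1E s2E]] := (borel_piP _ _).1 (s12 t).
    have hk : h t = k by apply: (@ract_inj (s2 (r t)).1); rewrite hP.
    rewrite rt in s1E s2E.
    by rewrite hk s2E -lactM mulVg lact1 -s1E; case: (s1 t).
have c1 : continuous (fun t => (s t).1).
  by move=> t; apply: (@continuous_comp _ _ _ s fst); [exact: cts_fun|exact: cvg_fst].
have c2 : continuous (fun t => (s t).2).
  by move=> t; apply: (@continuous_comp _ _ _ s snd); [exact: cts_fun|exact: cvg_snd].
exists (to_simplex c1), (to_simplex c2); apply: simplexP => t /=.
by rewrite -sP; case: (s t).
Qed.

(** Together with [borel_simplex_lift], this identifies simplices of the Borel construction with
    Sing(H)-orbits, so invariant functions of (s, x) are exactly cochains on it. *)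
Lemma borel_simplex_eq n (s s' : Sing E n) (x x' : Sing X n) :
  borel_simplex s x = borel_simplex s' x' ->
  exists h : Sing H n, s = simplex_act (@ract_continuous _ P) s' h /\
    forall t, x' t = a (h t) (x t).
Proof.
move=> E12; have Et t : borel_pi (s t, x t) = borel_pi (s' t, x' t).
  exact: (congr1 (fun f : Sing Q n => f t) E12).
have [h [hc hP]] : exists h : @standard_simplex R n -> H, continuous h /\
    forall t, ract (s' t) (h t) = s t.
  apply: bundle_translation; [exact: cts_fun|exact: cts_fun|] => t.
  by have [h [/= -> _]] := (borel_piP _ _).1 (Et t); rewrite bundle_proj_ract.
exists (to_simplex hc); split=> [|t]; first by apply: simplexP => t; rewrite /= hP.
have [k [/= sk ->]] := (borel_piP _ _).1 (Et t).
by congr (a _ _); apply: (@ract_inj (s' t)); rewrite hP.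
Qed.

End PrincipalBundle.

(** * The prism operator *)

(** The cancellation in the prism operator: [T i j] is the j-th term of the cocycle condition on the
    i-th degeneracy. The terms j = i and j = i.+1 give differences of [p] that telescope; the others
    reassemble into a coboundary. *)
Lemma prism_sum (n : nat) (p : nat -> rat) (A T : nat -> nat -> rat) :
  (forall i j, (j < i <= n)%N -> T i j = (-1) ^+ j * A i.-1 j) ->
  (forall i, (i <= n)%N -> T i i = (-1) ^+ i * p i) ->
  (forall i, (i <= n)%N -> T i i.+1 = (-1) ^+ i.+1 * p i.+1) ->
  (forall i j, (i < j <= n)%N -> T i j.+1 = (-1) ^+ j.+1 * A i j) ->
  (forall i, (i <= n)%N -> \sum_(0 <= j < n.+2) T i j = 0) ->
  p 0 - p n.+1 =
    \sum_(0 <= l < n.+1) (-1) ^+ l * \sum_(0 <= i < n) (-1) ^+ i * A i l.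
Proof.
move=> Tlt Tii Tii1 Tgt T0.
pose lo i := \sum_(0 <= l < i) (-1) ^+ l * A i.-1 l.
pose hi i := \sum_(i.+1 <= l < n.+1) (-1) ^+ l * A i l.
have pE i : (i <= n)%N -> p i - p i.+1 = (-1) ^+ i * (hi i - lo i).
  move=> iN; have := T0 i iN.
  rewrite (@big_cat_nat _ _ _ i)//=; last by lia.
  rewrite (@big_ltn _ _ _ i); last by lia.
  rewrite (@big_ltn _ _ _ i.+1); last by lia.
  rewrite Tii// Tii1//.
  have -> : \sum_(0 <= j < i) T i j = lo i.
    by apply: eq_big_nat => j ji; rewrite Tlt//; lia.
  have -> : \sum_(i.+2 <= j < n.+2) T i j = - hi i.
    rewrite /hi -sumrN big_add1 /=; apply: eq_big_nat => j ij.
    by rewrite Tgt; [rewrite exprS mulN1r mulNr|lia].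
  have s2 : (-1) ^+ i * (-1) ^+ i = 1 :> rat by rewrite -expr2 -exprM mulnC exprM sqrrN expr1n.
  rewrite exprS => E0.
  have -> : hi i - lo i = (-1) ^+ i * (p i - p i.+1) by lra.
  by rewrite mulrA s2 mul1r.
transitivity (\sum_(0 <= i < n.+1) (-1) ^+ i * (hi i - lo i)).
  have -> : p 0%N - p n.+1 = \sum_(0 <= i < n.+1) (p i - p i.+1).
    rewrite -[LHS]opprB -(telescope_sumr p)// -sumrN.
    by apply: eq_bigr => i _; rewrite opprB.
  by apply: eq_big_nat => i iN; rewrite pE.
(* [hi n] and [lo 0] are empty sums. After a shift of [lo] by one, [hi i] and [lo i.+1] contain the
   terms [A i l] with l > i and l <= i. *)
transitivity (\sum_(0 <= i < n) (-1) ^+ i * (hi i + lo i.+1)).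
  under eq_bigr do rewrite mulrBr.
  rewrite sumrB big_nat_recr//= [X in _ * X]big_geq// mulr0 addr0.
  rewrite big_nat_recl// [X in _ * X]big_geq// mulr0 add0r -sumrB.
  by apply: eq_bigr => i _; rewrite exprS mulN1r mulNr opprK -mulrDr.
under [RHS]eq_bigr do rewrite mulr_sumr.
rewrite exchange_big_nat/=; apply: eq_big_nat => i iN.
rewrite addrC -(@big_cat_nat _ _ _ i.+1)//= 1?ltnW// mulr_sumr.
by apply: eq_bigr => l _; rewrite mulrCA.
Qed.

Section Prism.
Context (R : realType) (X : topologicalType).
Local Notation Sing := (singular_simplex R).

Lemma push_simplex_continuous m n (th : 'I_m.+1 -> 'I_n.+1) (s : Sing X n) :
  continuous (fun t => s (push th t)).
Proof.
move=> t; apply: (@continuous_comp _ _ _ (push th) s); first exact: push_continuous.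
exact: cts_fun.
Qed.

Definition push_simplex m n (th : 'I_m.+1 -> 'I_n.+1) (s : Sing X n) : Sing X m :=
  to_simplex (@push_simplex_continuous m n th s).

Definition degen n (i : nat) (s : Sing X n) : Sing X n.+1 :=
  push_simplex (fun j : 'I_n.+2 => inord (j - (i < j))) s.

Lemma face_degen n (i : nat) (j : 'I_n.+2) (s : Sing X n) :
  (i <= n)%N -> (j == i :> nat) || (j == i.+1 :> nat) -> face j (degen i s) = s.
Proof.
move=> iN ji; apply: simplexP => t; rewrite /= face_mapE push_comp.
rewrite -[in RHS](push_id t); congr (s _); apply: eq_push => k /=.
by apply: val_inj; rewrite /= inordK /bump; have := ltn_ord k; lia.
Qed.

Lemma face_degen_lt n (i : nat) (j : nat) (s : Sing X n.+1) :
  (j < i <= n.+1)%N ->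
  face (inord j) (degen i s) = degen i.-1 (face (inord j) s).
Proof.
move=> ji; apply: simplexP => t; rewrite /= !face_mapE !push_comp.
congr (s _); apply: eq_push => k /=; apply: val_inj.
have jE : (inord j : 'I_n.+3) = j :> nat by rewrite inordK//; lia.
have jE' : (inord j : 'I_n.+2) = j :> nat by rewrite inordK//; lia.
by have kn := ltn_ord k; rewrite /= /bump jE jE' !inordK; lia.
Qed.

Lemma face_degen_gt n (i : nat) (j : nat) (s : Sing X n.+1) :
  (i < j <= n.+1)%N ->
  face (inord j.+1) (degen i s) = degen i (face (inord j) s).
Proof.
move=> ij; apply: simplexP => t; rewrite /= !face_mapE !push_comp.
congr (s _); apply: eq_push => k /=; apply: val_inj.
have jE : (inord j.+1 : 'I_n.+3) = j.+1 :> nat by rewrite inordK//; lia.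
have jE' : (inord j : 'I_n.+2) = j :> nat by rewrite inordK//; lia.
by have kn := ltn_ord k; rewrite /= /bump jE jE' !inordK; lia.
Qed.

(* psi k is a cochain in which the first k vertices have been moved; the
   hypothesis is its cocycle condition. *)
Lemma prism (n : nat) (psi : nat -> cochain R X n) :
  (forall k (x : Sing X n.+1), (k <= n.+2)%N ->
    \sum_(j < n.+2) (-1) ^+ j * psi (k - (j < k))%N (face j x) = 0) ->
  @coboundary R X n (fun s => psi 0%N s - psi n.+1 s).
Proof.
move=> psi0.
(* The cocycle condition for k = i.+1 on [degen i x]: of the two copies of vertex i, the first is
   moved and the second is not. Deleting the first leaves i moved vertices, deleting the second
   leaves i.+1. *)
pose T (x : Sing X n) i j :=
  (-1) ^+ j * psi (i.+1 - (j < i.+1))%N (face (inord j) (degen i x)).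
have T0 x i : (i <= n)%N -> \sum_(0 <= j < n.+2) T x i j = 0.
  move=> iN; rewrite big_mkord -[RHS](psi0 i.+1 (degen i x)); last by lia.
  by apply: eq_bigr => j _; rewrite /T inord_val.
have Tii x i : (i <= n)%N -> T x i i = (-1) ^+ i * psi i x.
  by move=> iN; rewrite /T ltnSn subSS subn0 face_degen// inordK ?eqxx//; lia.
have Tii1 x i : (i <= n)%N -> T x i i.+1 = (-1) ^+ i.+1 * psi i.+1 x.
  by move=> iN; rewrite /T ltnn subn0 face_degen// inordK ?eqxx ?orbT//; lia.
case: n psi psi0 @T T0 Tii Tii1 => [|n] psi psi0 T T0 Tii Tii1.
  apply/funext => x; pose A (_ _ : nat) := 0 : rat.
  have -> := @prism_sum 0%N (fun i => psi i x) A (T x) _ (Tii x) (Tii1 x) _ (T0 x).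
  - by rewrite big_nat1 big_geq// mulr0.
  - by move=> i j; lia.
  - by move=> i j; lia.
exists (fun y => \sum_(0 <= i < n.+1) (-1) ^+ i * psi i.+1 (degen i y)) => //.
apply/funext => x; apply/esym.
pose A i l := psi i.+1 (degen i (face (inord l) x)).
have -> := @prism_sum n.+1 (fun i => psi i x) A (T x) _ (Tii x) (Tii1 x) _ (T0 x).
- by rewrite big_mkord; apply: eq_bigr => l _; rewrite /A inord_val.
- move=> i j ji; rewrite /T face_degen_lt// /A.
  by have -> : (i.+1 - (j < i.+1) = i.-1.+1)%N by lia.
- move=> i j ij; rewrite /T face_degen_gt// /A.
  by have -> : (i.+1 - (j.+1 < i.+1) = i.+1)%N by lia.
Qed.

End Prism.

(** * Topological groups *)

(* Baire: otherwise there are nonempty open sets U 0, U 1, ... with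
   closure (U n.+1) contained in U n and disjoint from F n. *)
Lemma compact_baire (T : topologicalType) (F : nat -> set T) (x0 : T) :
  hausdorff_space T -> compact [set: T] -> (forall n, closed (F n)) ->
  (forall x, exists n, F n x) -> exists n (x : T), nbhs x (F n).
Proof.
move=> hT cT cF Fcov; apply: contrapT => nF.
have Fint n (x : T) : ~ nbhs x (F n) by move=> Fnx; apply: nF; exists n, x.
have step (nU : nat * set T) : exists V, open nU.2 -> nU.2 !=set0 ->
    [/\ open V, V !=set0, closure V `<=` nU.2 & closure V `<=` ~` F nU.1].
  case: nU => n U /=; have [[oU U0]|nU] := pselect (open U /\ U !=set0); last first.
    by exists setT => oU U0; case: nU.
  have [x [Ux Fx]] : exists x, U x /\ ~ F n x.
    apply: contrapT => UF; have [x Ux] := U0; apply: (Fint n x).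
    apply: filterS (open_nbhs_nbhs (conj oU Ux)) => y Uy.
    by apply: contrapT => Fy; apply: UF; exists y.
  have UFx : nbhs x (U `&` ~` F n).
    apply: open_nbhs_nbhs; split=> //; apply: openI => //.
    by rewrite openC.
  have [W Wx WUF] := compact_regular hT cT filterT UFx.
  move: Wx; rewrite nbhsE => -[V [oV Vx] VW].
  exists V => _ _; split=> //; first by exists x.
    by move=> y /(closure_subset VW)/WUF[].
  by move=> y /(closure_subset VW)/WUF[].
have [f fP] := choice step.
pose U := fix U n := if n is m.+1 then f (m, U m) else [set: T].
have UP n : open (U n) /\ U n !=set0.
  elim: n => [|n [oU U0]] /=; first by split; [exact: openT|exists x0].
  by have [] := fP (n, U n) oU U0.
have Uclos n : closure (U n.+1) `<=` U n /\ closure (U n.+1) `<=` ~` F n.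
  by have [oU U0] := UP n; have [] := fP (n, U n) oU U0.
have Umono m n : (m <= n)%N -> U n `<=` U m.
  elim: n => [|n IHn]; first by rewrite leqn0 => /eqP ->.
  rewrite leq_eqVlt => /predU1P[-> //|/IHn Unm] x Ux.
  by apply: Unm; apply: (Uclos n).1; exact: subset_closure.
have Ffilter : ProperFilter (filter_from [set: nat] U).
  apply: filter_from_proper; last by move=> n _; exact: (UP n).2.
  apply: filter_from_filter; first by exists 0%N.
  move=> m n _ _; exists (maxn m n) => // x Ux.
  by split; apply: Umono Ux; rewrite ?leq_maxl ?leq_maxr.
have [x [_ xcl]] := cT _ Ffilter filterT.
have [n Fnx] := Fcov x; apply: (Uclos n).2 (Fnx) => W Wx.
by apply: xcl => //; exists n.+1.
Qed.

Lemma Lie_group_locally_compact (R : realType) (G : topologicalGroupType) (U : set G) :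
  Lie_group R G -> nbhs (1%g : G) U ->
  exists V : set G, [/\ compact V, nbhs (1%g : G) V & V `<=` U].
Proof.
move=> [_ _ [n [A [[Acov _] _ _]]]] U1; have [c Ac c1] := Acov 1%g.
pose y0 := chart_map c 1%g.
have y0c : chart_cod c y0 := chart_mapP c1.
have invc := chart_inv_continuous y0c.
have : nbhs y0 (chart_cod c `&` chart_inv c @^-1` U).
  apply: filterI; first by apply: open_nbhs_nbhs; split=> //; exact: chart_cod_open.
  by apply: invc; rewrite chart_mapK.
move=> /nbhs_ballP[r /= r0 rU].
pose Q : set 'rV[R]_n :=
  [set v | forall i, `[y0 0 i - r / 2, y0 0 i + r / 2]%classic (v 0 i)].
have Qcpt : compact Q.
  by apply: (@rV_compact R n (fun i => `[y0 0 i - r / 2, y0 0 i + r / 2]%classic))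
    => i; exact: segment_compact.
have Qr : Q `<=` ball y0 r.
  move=> v Qv; split=> // i j; rewrite (ord1 i) /ball /= ltr_norml.
  by have := Qv j; rewrite /= in_itv/= => /andP[? ?]; apply/andP; split; lra.
exists (chart_inv c @` Q); split.
- apply: continuous_compact Qcpt; apply/subspace_continuousP => v Qv.
  apply: cvg_within_filter; apply: chart_inv_continuous.
  by have [] := rU _ (Qr _ Qv).
- have mapc := chart_map_continuous c1.
  have near_dom : nbhs (1%g : G) (chart_dom c).
    by apply: open_nbhs_nbhs; split=> //; exact: chart_dom_open.
  have near_map : \forall x \near (1%g : G), ball y0 (r / 2) (chart_map c x).
    apply: (continuous_near mapc); apply: nbhsx_ballx.
    by rewrite divr_gt0.
  apply: filterS2 near_dom near_map => x cx [_ bx].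
  exists (chart_map c x); last exact: chart_mapK.
  move=> i; have := bx 0 i; rewrite /ball /= ltr_norml in_itv/=.
  by move=> /andP[? ?]; apply/andP; split; lra.
- by move=> _ [v Qv <-]; have [] := rU _ (Qr _ Qv).
Qed.

Section TopologicalGroup.
Context (G : topologicalGroupType).
Implicit Types (x y g : G).

Lemma nbhs_mulg g (U : set G) : nbhs g U -> nbhs (1%g : G) [set x | U (g * x)%g].
Proof.
by move=> Ug; apply: (@lmulg_continuous G g 1%g); rewrite mulg1.
Qed.

Lemma nbhs_translate g (V : set G) : nbhs (1%g : G) V ->
  nbhs g [set x | V (g^-1 * x)%g].
Proof. by move=> V1; apply: (@lmulg_continuous G (g^-1)%g g); rewrite mulVg. Qed.

Lemma divg_continuous : continuous (fun z : G * G => (z.1^-1 * z.2)%g).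
Proof.
move=> z; apply: (@continuous_comp2 _ _ _ _ (fun z : G * G => (z.1^-1)%g) snd
  (fun z : G * G => (z.1 * z.2)%g)).
- apply: (@continuous_comp _ _ _ fst (fun x : G => (x^-1)%g)); first exact: cvg_fst.
  exact: invg_continuous.
- exact: cvg_snd.
- exact: mulg_continuous.
Qed.

Lemma nbhs_divg (U : set G) : nbhs (1%g : G) U -> exists V : set G,
  nbhs (1%g : G) V /\ forall x y, V x -> V y -> U (x^-1 * y)%g.
Proof.
move=> U1; have : nbhs ((1%g, 1%g) : G * G) [set z | U (z.1^-1 * z.2)%g].
  by apply: divg_continuous; rewrite /= invg1 mulg1.
move=> [[A B] /= [A1 B1] AB]; exists (A `&` B); split; first exact: filterI.
by move=> x y [Ax _] [_ By]; exact: (AB (x, y)).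
Qed.

Lemma second_countable_translates (V : set G) : @second_countable G ->
  nbhs (1%g : G) V -> exists g : nat -> G, forall x, exists n, V ((g n)^-1 * x)%g.
Proof.
move=> [B /countable_injP[f finj] [Bo Bb]] V1.
have /choice[g gP] n : exists g, forall U, B U -> f U = n ->
    (exists y, U `<=` [set x | V (y^-1 * x)%g]) -> U `<=` [set x | V (g^-1 * x)%g].
  have [[U [BU fU [y UV]]]|nU] := pselect (exists U, [/\ B U, f U = n &
      exists y, U `<=` [set x | V (y^-1 * x)%g]]).
    exists y => U' BU' fU' _; suff -> : U' = U by [].
    by apply: finj; rewrite ?inE// fU' fU.
  by exists 1%g => U BU fU yU; case: nU; exists U.
exists g => x; have [U [BU Ux] UV] := Bb x _ (nbhs_translate x V1).
by exists (f U); apply: (gP _ U BU erefl) Ux; exists x.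
Qed.

Lemma coset_space_hausdorff (K : subgroup G) :
  closed (subgroup_set K) -> hausdorff_space (coset_space K).
Proof.
move=> Kcl; rewrite open_hausdorff => x y.
rewrite -(coset_piK x) -(coset_piK y); move: (repr x) (repr y) => g h gh.
have nK : nbhs (g^-1 * h)%g (~` subgroup_set K).
  apply: open_nbhs_nbhs; split; first by rewrite openC.
  by move=> Kgh; move/eqP: gh; apply; apply/coset_piP.
have := continuous_near (@divg_continuous (g, h)) nK.
move=> [[A B] /= [Ag Bh] AB].
exists (@coset_pi G K @` A°, @coset_pi G K @` B°) => /=.
  by split; apply/mem_set; [exists g|exists h].
split; [by apply: coset_pi_open; exact: open_interior..|].
apply/eqP; rewrite -subset0 => _ [[a /interior_subset Aa <-] [b /interior_subset Bb]].
move=> /esym/coset_piP; exact: (AB (a, b)).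
Qed.

End TopologicalGroup.

(** Paths are multiplied pointwise rather than concatenated, so the points reached from 1 form a
    subgroup. It contains a neighbourhood of 1, by straight segments in a chart, and is therefore
    clopen. *)
Lemma Lie_group_path (R : realType) (G : topologicalGroupType) (g : G) :
  Lie_group R G -> connected [set: G] ->
  exists c : R -> G, [/\ continuous c, c 0 = 1%g & c 1 = g].
Proof.
move=> LG conG; pose P : set G := [set g | exists c : R -> G,
  [/\ continuous c, c 0 = 1%g & c 1 = g]].
have PM x y : P x -> P y -> P (x * y)%g.
  move=> [c [cc c0 c1]] [d [dc d0 d1]]; exists (fun t => (c t * d t)%g).
  split; rewrite ?c0 ?d0 ?mulg1 ?c1 ?d1// => t.
  apply: (@continuous_comp2 _ _ _ _ c d (fun z : G * G => (z.1 * z.2)%g)).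
  - exact: cc.
  - exact: dc.
  - exact: mulg_continuous.
have PV x : P x -> P (x^-1)%g.
  move=> [c [cc c0 c1]]; exists (fun t => (c t)^-1)%g.
  split; rewrite ?c0 ?c1 ?invg1// => t.
  apply: (@continuous_comp _ _ _ c (fun x : G => (x^-1)%g)); first exact: cc.
  exact: invg_continuous.
have P1 : nbhs (1%g : G) P.
  have [_ _ [n [A [[Acov _] _ _]]]] := LG; have [c Ac c1] := Acov 1%g.
  pose y0 := chart_map c 1%g.
  have : nbhs y0 (chart_cod c).
    apply: open_nbhs_nbhs; split; first exact: chart_cod_open.
    exact: chart_mapP.
  move=> /nbhs_ballP[r /= r0 rU].
  have mapc := chart_map_continuous c1.
  have near_dom : nbhs (1%g : G) (chart_dom c).
    by apply: open_nbhs_nbhs; split=> //; exact: chart_dom_open.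
  have near_map : \forall x \near (1%g : G), ball y0 r (chart_map c x).
    by apply: (continuous_near mapc); exact: nbhsx_ballx.
  apply: filterS2 near_dom near_map => x cx [_ bx].
  pose cl (t : R) := Num.max 0 (Num.min 1 t).
  pose l (t : R) : 'rV[R]_n := \row_i (y0 0 i + cl t * (chart_map c x 0 i - y0 0 i)).
  have lc : continuous l.
    move=> t; apply: row_continuous => i.
    rewrite (_ : (fun _ => _) = (fun t => y0 0 i + cl t * (chart_map c x 0 i - y0 0 i))).
      apply: fun_addr_continuous; first exact: cst_continuous.
      apply: fun_mulr_continuous; last exact: cst_continuous.
      apply: fun_maxr_continuous; first exact: cst_continuous.
      by apply: fun_minr_continuous; [exact: cst_continuous|exact: cvg_id].
    by apply/funext => u; rewrite mxE.
  have lcod t : chart_cod c (l t).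
    apply: rU; split=> // i j; rewrite (ord1 i) mxE /ball /= opprD addNKr normrN normrM.
    have := bx 0 j; rewrite /ball /= distrC; apply: le_lt_trans.
    rewrite ler_piMl// ger0_norm ?ge_max ?ler01 ?ge_min ?lexx//.
    by rewrite le_max lexx.
  exists (chart_inv c \o l); split.
  - move=> t; apply: continuous_comp; first exact: lc.
    exact: chart_inv_continuous.
  - rewrite /= (_ : l 0 = y0) ?chart_mapK//; apply/rowP => i.
    by rewrite mxE /cl min_r ?ler01// maxxx mul0r addr0.
  - rewrite /= (_ : l 1 = chart_map c x) ?chart_mapK//; apply/rowP => i.
    by rewrite mxE /cl minxx max_r ?ler01// mul1r subrKC.
have Pop x : nbhs x [set y | P x <-> P y].
  apply: filterS (nbhs_translate x P1) => y /= Pxy; split=> [Px|Py].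
    by have := PM _ _ Px Pxy; rewrite mulVKg.
  by have := PM _ _ Py (PV _ Pxy); rewrite invgM invgK mulVKg.
suff PT : P = [set: G] by have : P g by rewrite PT.
apply: conG.
- by exists 1%g; exact: nbhs_singleton P1.
- exists P; last by rewrite setTI.
  by rewrite openE => x Px; apply: filterS (Pop x) => y [+ _]; exact.
- exists P; last by rewrite setTI.
  rewrite -[P]setCK closedC openE => x Px.
  by apply: filterS (Pop x) => y [_ Pyx] /Pyx.
Qed.

Lemma finite_set_enum (T : choiceType) (A : set T) : finite_set A ->
  exists (J : finType) (v : J -> T), injective v /\ forall x, A x <-> exists j, v j = x.
Proof.
move=> /finite_seqP[s ->]; exists (seq_sub s), val; split; first exact: val_inj.
move=> x; split=> [sx|[j <-]]; last exact: valP.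
by exists (SeqSub sx).
Qed.

Lemma finite_bigcup_closed (T : topologicalType) (J : finType) (D : J -> set T) :
  (forall j, closed (D j)) -> closed (\bigcup_j D j).
Proof.
move=> cD; rewrite -[X in closed X]setCK closedC setC_bigcup openE => x Dx.
have : \forall y \near x, forall j, ~ D j y.
  apply: near_forall => j; apply: open_nbhs_nbhs; split; first by rewrite openC.
  exact: Dx.
by apply: filterS => y Dy j _; exact: Dy.
Qed.

(** * The covering homomorphism is open and closed; the identity component H *)

Section Covering.
Context (R : realType) (G Gt : topologicalGroupType) (p : UMagmaMorphism.type Gt G).
Hypothesis p_covering : finite_central_covering R p.
Hypothesis G_hausdorff : hausdorff_space G.
Hypothesis G_compact : compact [set: G].

Let p_surj (y : G) : exists x, p x = y.
Proof. by have [x _ <-] := @covering_surjective _ _ _ _ p_covering y I; exists x. Qed.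

Let pM x y : p (x * y)%g = (p x * p y)%g. Proof. exact: gmulfM. Qed.
Let pV x : p (x^-1)%g = ((p x)^-1)%g. Proof. exact: gmulfV. Qed.

(** Open mapping argument: countably many translates of a compact neighbourhood V cover Gt, their
    images are closed in G, and by Baire one of them has an interior point. Quotients of elements of
    V stay in U. *)
Lemma covering_nbhs1 (U : set Gt) : nbhs (1%g : Gt) U -> nbhs (1%g : G) (p @` U).
Proof.
move=> U1; have LG := covering_Lie_group p_covering.
have [V0 [V01 V0U]] := nbhs_divg U1.
have [V [Vc V1 VV0]] := Lie_group_locally_compact LG V01.
have [hGt sc _] := LG.
have [g gP] := second_countable_translates sc V1.
pose F n : set G := [set y | (p @` V) ((p (g n))^-1 * y)%g].
have pVcl : closed (p @` V).
  apply: compact_closed => //; apply: continuous_compact => //.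
  apply: continuous_subspaceT; exact: (covering_continuous p_covering).
have Fcl n : closed (F n).
  apply: (@closed_comp _ _ (fun y => ((p (g n))^-1 * y)%g) (p @` V)) => // y _.
  exact: lmulg_continuous.
have Fcov y : exists n, F n y.
  have [x <-] := p_surj y; have [n Vn] := gP x; exists n.
  by exists ((g n)^-1 * x)%g => //; rewrite pM pV.
have [n [y Fny]] := compact_baire 1%g G_hausdorff G_compact Fcl Fcov.
have [v Vv vE] := nbhs_singleton Fny.
apply: filterS (nbhs_mulg Fny) => x /= -[w Vw wE].
exists (v^-1 * w)%g; first by apply: V0U; exact: VV0.
rewrite pM pV wE vE mulgA.
by rewrite invgM invgK -!mulgA mulVKg mulKg.
Qed.

Lemma covering_open (U : set Gt) : open U -> open (p @` U).
Proof.
move=> oU; rewrite openE => _ [x Ux <-].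
have := nbhs_translate (p x) (covering_nbhs1 (nbhs_mulg (open_nbhs_nbhs (conj oU Ux)))).
apply: filterS => y /= [z Uz zE]; exists (x * z)%g => //.
by rewrite pM zE mulVKg.
Qed.

Lemma covering_ker x y : p x = p y -> exists z, p z = 1%g /\ y = (z * x)%g.
Proof.
by move=> xy; exists (y * x^-1)%g; rewrite pM pV xy mulgV mulgVK.
Qed.

Lemma covering_closed (D : set Gt) : closed D -> closed (p @` D).
Proof.
move=> cD; have [J [v [_ vP]]] := finite_set_enum (covering_finite_kernel p_covering).
have oC : open (p @` (~` \bigcup_j [set x | D (v j * x)%g])).
  apply: covering_open; rewrite openC; apply: finite_bigcup_closed => j.
  apply: (@closed_comp _ _ (fun x => (v j * x)%g) D) => // x _.
  exact: lmulg_continuous.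
rewrite -[p @` D]setCK closedC; suff -> : ~` (p @` D) =
  p @` (~` \bigcup_j [set x | D (v j * x)%g]) by [].
apply/seteqP; split=> [y nDy|_ [x nDx <-] [y Dy yx]].
  have [x xy] := p_surj y; exists x => // -[j _ /= Dx]; apply: nDy.
  exists (v j * x)%g => //; rewrite pM xy.
  by have /= -> := (vP (v j)).2 (ex_intro _ j erefl); rewrite mul1g.
have [z [pz yE]] := covering_ker (esym yx).
have [j jz] := (vP z).1 pz.
by apply: nDx; exists j => //=; rewrite jz -yE.
Qed.

Section Component.
Context (K : subgroup G).
Hypothesis K_connected : connected (subgroup_set K).

Let Kt := preimage_subgroup p K.
Let H := identity_component Kt.

Let relopen (C : set Gt) := exists2 W, open W & C = subgroup_set Kt `&` W.
Let relclosed (C : set Gt) := exists2 D, closed D & C = subgroup_set Kt `&` D.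

(** [p] is open and closed and [Kt] is a full preimage, so the image is relatively clopen in the
    connected K. *)
Let relclopen_image C : C !=set0 -> relopen C -> relclosed C ->
  p @` C = subgroup_set K.
Proof.
move=> [c Cc] [W oO CO] [D cD CD]; apply: K_connected; first by exists (p c), c.
  exists (p @` W); first exact: covering_open.
  rewrite CO; apply/seteqP; split=> [_ [x [Kx Ox] <-]|y [Ky [x Ox xy]]].
    by split=> //; exists x.
  by exists x => //; split=> //; rewrite /Kt /= /preimage /= xy.
exists (p @` D); first exact: covering_closed.
rewrite CD; apply/seteqP; split=> [_ [x [Kx Dx] <-]|y [Ky [x Dx xy]]].
  by split=> //; exists x.
by exists x => //; split=> //; rewrite /Kt /= /preimage /= xy.
Qed.

(* A relatively clopen neighbourhood of 1 containing as few points of the kernel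
   as possible is connected, since its nonempty clopen subsets surject onto K. *)
Lemma identity_component_relclopen :
  [/\ relopen H, relclosed H & p @` (subgroup_set H) = subgroup_set K].
Proof.
have [J [v [_ vP]]] := finite_set_enum (covering_finite_kernel p_covering).
pose clop (C : set Gt) := [/\ C 1%g, relopen C & relclosed C].
pose cnt (C : set Gt) := #|[pred j : J | `[< C (v j) >]]|.
have exn : exists n, `[< exists2 C : set Gt, clop C & cnt C = n >].
  exists (cnt (subgroup_set Kt)); apply/asboolP; exists (subgroup_set Kt) => //; split.
  - exact: subgroup1.
  - by exists setT; [exact: openT|rewrite setIT].
  - by exists setT; [exact: closedT|rewrite setIT].
have [_ /asboolP[C [C1 oC cC] <-] Cmin] := ex_minnP exn.
have CK : C `<=` subgroup_set Kt by case: oC => W _ -> x [].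
(* B would surject onto K and so contain a kernel point; C' misses it, so C' would have fewer kernel
   points than the minimal C. *)
have less C' : C' `<=` C -> relopen C' -> relclosed C' -> C' 1%g ->
    forall B, B `<=` C -> B `&` C' = set0 -> relopen B -> relclosed B -> ~ (B !=set0).
  move=> C'C oC' cC' C'1 B BC BC' oB cB B0.
  have : (cnt C <= cnt C')%N by apply: Cmin; apply/asboolP; exists C'.
  rewrite leqNgt => /negP; apply; apply: proper_card; apply/properP; split.
    by apply/fintype.subsetP => j /asboolP Cj; exact/asboolP/C'C.
  have : (p @` B) 1%g by rewrite relclopen_image//; exact: subgroup1.
  move=> [z Bz pz]; have [j jz] := (vP z).1 pz; exists j.
    by apply/asboolP; rewrite jz; exact: BC.
  apply/negP => /asboolP; rewrite jz => C'z.
  by have : (B `&` C') z by []; rewrite BC'.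
have conC : connected C.
  move=> B B0 [W oO BO] [D cD BD].
  have BC : B `<=` C by rewrite BO => x [].
  have oB : relopen B.
    by case: oC => W' oO' CO'; exists (W' `&` W); [exact: openI|rewrite BO CO' setIA].
  have cB : relclosed B.
    by case: cC => D' cD' CD'; exists (D' `&` D); [exact: closedI|rewrite BD CD' setIA].
  have oB' : relopen (C `\` B).
    case: oC => W' oO' CO'; exists (W' `&` ~` D).
      by apply: openI => //; rewrite openC.
    by rewrite setIA -CO' BD setDIr setDv set0U.
  have cB' : relclosed (C `\` B).
    case: cC => D' cD' CD'; exists (D' `&` ~` W).
      by apply: closedI => //; rewrite closedC.
    by rewrite setIA -CD' BO setDIr setDv set0U.
  have BB' : B `&` (C `\` B) = set0 by apply/seteqP; split=> x // [Bx [_]].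
  apply/seteqP; split=> // x Cx; apply: contrapT => Bx.
  have [B1|B1] := pselect (B 1%g).
    have B'B : (C `\` B) `&` B = set0 by rewrite setIC.
    have C'C : C `\` B `<=` C by move=> y [].
    by apply: (less B BC oB cB B1 _ C'C B'B oB' cB'); exists x.
  by apply: (less (C `\` B) _ oB' cB' _ B) => // y [].
have HC : subgroup_set H = C.
  apply/seteqP; split; last exact: connected_component_max.
  have HCH : subgroup_set H `&` C = subgroup_set H.
    apply: component_connected.
    - by exists 1%g; split=> //; exact: subgroup1.
    - case: oC => W oO CO; exists W => //; rewrite CO setIA.
      by congr (_ `&` _); apply/setIidPl; exact: connected_component_sub.
    - case: cC => D cD CD; exists D => //; rewrite CD setIA.
      by congr (_ `&` _); apply/setIidPl; exact: connected_component_sub.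
  by rewrite -HCH => x [].
by rewrite HC; split=> //; apply: relclopen_image => //; exists 1%g.
Qed.

End Component.
End Covering.

(** * Finite coverings *)

Lemma row_connected (R : realType) (n : nat) : connected [set: 'rV[R]_n].
Proof.
pose line (v : 'rV[R]_n) := (fun s : R => s *: v) @` [set: R].
have -> : [set: 'rV[R]_n] = \bigcup_v line v.
  by apply/seteqP; split=> v // _; exists v => //; exists 1 => //; rewrite scale1r.
apply: bigcup_connected => [|v _].
  by exists 0 => v _; exists 0 => //; rewrite scale0r.
apply: connected_continuous_connected; first by apply/connected_intervalP.
by apply: continuous_subspaceT; exact: scalel_continuous.
Qed.

Section FiniteCover.
Context (Y B : topologicalType) (q : Y -> B) (J : finType) (act : J -> Y -> Y).
Hypothesis Y_hausdorff : hausdorff_space Y.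
Hypothesis q_open : forall U, open U -> open (q @` U).
Hypothesis q_surj : forall b, exists y, q y = b.
Hypothesis act_continuous : forall j, continuous (act j).
Hypothesis q_act : forall j y, q (act j y) = q y.
Hypothesis q_fiber : forall y y', q y = q y' -> exists j, y' = act j y.
(** [J] will index the whole kernel, whose elements lying in H act trivially on Gt/H; hence freeness
    is only asked of the maps that are not the identity. *)
Hypothesis act_semifree : forall j y y', act j y = y -> act j y' = y'.

Lemma finite_cover_locally_injective (y : Y) :
  exists U, [/\ open U, U y & forall u u', U u -> U u' -> q u = q u' -> u = u'].
Proof.
have sep j : exists U : set Y, [/\ open U, U y & act j y <> y ->
    forall u, U u -> ~ U (act j u)].
  have [jy|/eqP jy] := pselect (act j y = y).
    by exists setT; split=> //; exact: openT.
  move: Y_hausdorff; rewrite open_hausdorff => /(_ _ _ jy)[[A C] /= [/set_mem Ay /set_mem Cy]].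
  move=> [oA oC /eqP AC]; exists (act j @^-1` A `&` C); split=> //.
    apply: openI => //; apply: open_comp => // u _; exact: act_continuous.
  move=> _ u [Au _] [_ Cu].
  by have : (A `&` C) (act j u) by []; rewrite AC.
have /choice[U UP] := sep.
have nU : nbhs y [set u | forall j, U j u].
  by apply: near_forall => j; have [oU Uy _] := UP j; exact: open_nbhs_nbhs.
move: nU; rewrite nbhsE => -[V [oV Vy] VU]; exists V; split=> // u u' Vu Vu' uu'.
have [j u'E] := q_fiber uu'; have [jy|jy] := pselect (act j y = y).
  by rewrite u'E (act_semifree u jy).
have [_ _ Uj] := UP j; case: (Uj jy u (VU _ Vu j)).
by rewrite -u'E; exact: VU.
Qed.

Lemma finite_cover_agree (T : topologicalType) (f g : T -> Y) (t0 : T) :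
  connected [set: T] -> continuous f -> continuous g ->
  (forall t, q (f t) = q (g t)) -> f t0 = g t0 -> f = g.
Proof.
move=> conT fc gc fg fg0; suff E : [set t | f t = g t] = setT.
  by apply/funext => t; have : [set t | f t = g t] t by rewrite E.
apply: conT; first by exists t0.
- exists [set t | f t = g t]; last by rewrite setTI.
  rewrite openE => t /= ftgt.
  have [U [oU Uf Uinj]] := finite_cover_locally_injective (f t).
  have Ufn := continuous_near (fc t) (open_nbhs_nbhs (conj oU Uf)).
  rewrite ftgt in Uf.
  have Ugn := continuous_near (gc t) (open_nbhs_nbhs (conj oU Uf)).
  suff : \forall u \near t, f u = g u by [].
  by apply: filterS2 Ufn Ugn => u Uu Ugu; exact: Uinj.
- exists [set t | f t = g t]; last by rewrite setTI.
  rewrite -[X in closed X]setCK closedC openE => t /= /eqP ftgt.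
  move: Y_hausdorff; rewrite open_hausdorff => /(_ _ _ ftgt)[[A C] /= [/set_mem Af /set_mem Cg]].
  move=> [oA oC /eqP AC].
  have An := continuous_near (fc t) (open_nbhs_nbhs (conj oA Af)).
  have Cn := continuous_near (gc t) (open_nbhs_nbhs (conj oC Cg)).
  suff : \forall u \near t, f u <> g u by [].
  apply: filterS2 An Cn => u Au Cu fgu; rewrite fgu in Au.
  by have : (A `&` C) (g u) by []; rewrite AC.
Qed.

Lemma finite_cover_section (b : B) : exists U (s : B -> Y),
  [/\ open U, U b & forall c, U c -> {for c, continuous s} /\ q (s c) = c].
Proof.
have [y yb] := q_surj b.
have [U [oU Uy Uinj]] := finite_cover_locally_injective y.
have /choice[s sP] c : exists y', (q @` U) c -> U y' /\ q y' = c.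
  have [[u Uu uc]|nc] := pselect ((q @` U) c); first by exists u.
  by exists y.
exists (q @` U), s; split; [exact: q_open|by exists y|] => c Uc.
have [Us sc] := sP c Uc; split=> //.
move=> W; rewrite nbhsE => -[V [oV Vs] VW].
have : nbhs c (q @` (U `&` V)).
  apply: open_nbhs_nbhs; split; first by apply: q_open; exact: openI.
  by exists (s c).
apply: filterS => _ [u [Uu Vu] <-]; apply: VW => /=.
have Uqu : (q @` U) (q u) by exists u.
by have [Usu su] := sP _ Uqu; rewrite (Uinj _ _ Usu Uu su).
Qed.

Context (R : realType).
Local Notation Sing := (singular_simplex R).

Lemma finite_cover_simplex_lift n (tau : Sing B n) :
  exists s : Sing Y n, forall t, q (s t) = tau t.
Proof.
apply: simplex_lift; first exact: finite_cover_section.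
move=> s1 s2 r s1c s2c rc s12.
(* The deck transformation found at the origin works everywhere, since lifts over a connected space
   that agree at one point are equal. *)
have [j jE] := q_fiber (esym (s12 0)).
have E : s1 \o r = act j \o s2 \o r.
  apply: (@finite_cover_agree _ _ _ (0 : 'rV[R]_n.+1)).
  - exact: row_connected.
  - by move=> t; apply: continuous_comp; [exact: rc|exact: s1c].
  - move=> t; apply: (@continuous_comp _ _ _ r (act j \o s2)); first exact: rc.
    by apply: continuous_comp; [exact: s2c|exact: act_continuous].
  - by move=> t; rewrite /= q_act.
  - exact: jE.
exists (act j \o s2); split=> [||t rt].
- by move=> t; apply: continuous_comp; [exact: s2c|exact: act_continuous].
- by move=> t; rewrite /= q_act.
- by have := congr1 (fun h => h t) E; rewrite /= rt => ->.
Qed.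

Lemma finite_cover_simplex_eq n (s s' : Sing Y n) (t0 : @standard_simplex R n) :
  (forall t, q (s t) = q (s' t)) -> s t0 = s' t0 -> s = s'.
Proof.
move=> ss' s0.
have E : s \o @simplex_retr R n = s' \o @simplex_retr R n.
  apply: (@finite_cover_agree _ _ _ (val t0)).
  - exact: row_connected.
  - by move=> t; apply: continuous_comp; [exact: simplex_retr_continuous|exact: cts_fun].
  - by move=> t; apply: continuous_comp; [exact: simplex_retr_continuous|exact: cts_fun].
  - by move=> t; exact: ss'.
  - by rewrite /= simplex_retrK.
by apply: simplexP => t; have := congr1 (fun h => h (val t)) E; rewrite /= simplex_retrK.
Qed.

Lemma finite_cover_simplex_act n (s s' : Sing Y n) :
  (forall t, q (s t) = q (s' t)) -> exists j, forall t, s' t = act j (s t).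
Proof.
move=> ss'; have [j jE] := q_fiber (ss' (vertex R (ord0 : 'I_n.+1))).
exists j => t; suff -> : s' = map_simplex (@act_continuous j) s by [].
apply: (@finite_cover_simplex_eq _ _ _ (vertex R (ord0 : 'I_n.+1))) => //.
by move=> u; rewrite /= q_act.
Qed.

End FiniteCover.

(** * Left translations on coset spaces *)

Section CosetTranslation.
Context (G : topologicalGroupType) (K : subgroup G).

Definition coset_mul (g : G) (c : coset_space K) : coset_space K :=
  coset_pi K (g * repr c)%g.

Lemma coset_mul_pi g x : coset_mul g (coset_pi K x) = coset_pi K (g * x)%g.
Proof.
apply/coset_piP; rewrite invgM -mulgA mulKg.
by apply/coset_piP; exact: coset_piK.
Qed.

Lemma coset_mul_continuous2 :
  continuous (fun z : G * coset_space K => coset_mul z.1 z.2).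
Proof.
move=> [g c] W /=; rewrite -(coset_piK c); move: (repr c) => x.
rewrite coset_mul_pi => /coset_pi_continuous.
move=> /(@mulg_continuous G (g, x)) [[A B] /= [Ag Bx] ABW].
exists (A, @coset_pi G K @` B°) => /=.
  split=> //; apply: (@open_nbhs_nbhs _ (coset_pi K x)); split.
    by apply: coset_pi_open; exact: open_interior.
  by exists x.
move=> [h d] /= [Ah [y /interior_subset By <-]]; rewrite coset_mul_pi.
exact: (ABW (h, y)).
Qed.

Lemma coset_mul_continuous g : continuous (coset_mul g).
Proof.
move=> c; apply: (@continuous_comp2 _ _ _ _ (fun=> g) id
  (fun z : G * coset_space K => coset_mul z.1 z.2)).
- exact: cst_continuous.
- exact: cvg_id.
- exact: coset_mul_continuous2.
Qed.

Context (R : realType).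
Local Notation Sing := (singular_simplex R).

(* Left translations are homotopic to the identity along a path in G. *)
Lemma coset_mul_cohomologous (g : G) n (phi : cochain R (coset_space K) n) :
  Lie_group R G -> connected [set: G] -> @cocycle R (coset_space K) n phi ->
  @coboundary R (coset_space K) n (fun s =>
    phi (map_simplex (@coset_mul_continuous g) s) - phi s).
Proof.
move=> LG conG phi0; have [c [cc c0 c1]] := Lie_group_path g LG conG.
(* The path is followed up to the total weight of the vertices of index at least k: these are
   translated by g and the first k stay fixed. So k = 0 gives the translation and k = n.+1 the
   identity. *)
pose w m k (t : @standard_simplex R m) := \sum_(l < m.+1 | (k <= l)%N) val t 0 l.
have yc m k (x : Sing (coset_space K) m) :
    continuous (fun t => coset_mul (c (w m k t)) (x t)).
  move=> t; apply: (@continuous_comp2 _ _ _ _ (fun t => c (w m k t)) x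
    (fun z : G * coset_space K => coset_mul z.1 z.2)).
  - apply: (@continuous_comp _ _ _ (w m k) c); last exact: cc.
    apply: sum_continuous => l; exact: coord_simplex_continuous.
  - exact: cts_fun.
  - exact: coset_mul_continuous2.
pose y m k x : Sing (coset_space K) m := to_simplex (@yc m k x).
have y0 x : y n 0%N x = map_simplex (@coset_mul_continuous g) x.
  by apply: simplexP => t /=; rewrite /w simplex_sum c1.
have y1 x : y n n.+1 x = x.
  apply: simplexP => t /=; rewrite /w big_pred0; last first.
    by move=> l; rewrite leqNgt ltn_ord.
  by rewrite c0 -(coset_piK (x t)) coset_mul_pi mul1g.
have -> : (fun s => phi (map_simplex (@coset_mul_continuous g) s) - phi s) =
    (fun s => phi (y n 0%N s) - phi (y n n.+1 s)).
  by apply/funext => x; rewrite y0 y1.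
apply: (@prism R (coset_space K) n (fun k s => phi (y n k s))) => k x kn.
rewrite -[RHS](phi0 (y n.+1 k x)).
apply: eq_bigr => j _; congr (_ * phi _); apply: simplexP => t /=.
congr (coset_mul (c _) _); rewrite /w (bigID (fun l => l == j))/=.
rewrite [X in _ = X + _]big1 ?add0r; last first.
  by move=> l /andP[_ /eqP ->]; rewrite mxE unlift_none.
rewrite [RHS](reindex_onto (lift j) (fun l => odflt ord0 (unlift j l)))/=; last first.
  by move=> l /andP[_ lj]; case: unliftP lj => [l' -> //|->]; rewrite eqxx.
apply: eq_big => [l|l _]; last by rewrite mxE liftK.
rewrite liftK/= eqxx andbT [lift j l == j]eq_sym neq_lift andbT /bump.
by case: ltnP => ?; case: leqP => ? /=; lia.
Qed.

End CosetTranslation.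

(** * Cochains *)

Section CochainAlgebra.
Context (R : realType) (X : topologicalType).
Local Notation Sing := (singular_simplex R).

Lemma coboundary_mapE n (phi : cochain R X n) s :
  coboundary_map phi s = \sum_(i < n.+2) (-1) ^+ i * phi (face i s).
Proof. by []. Qed.

Lemma coboundaryN n (phi : cochain R X n) :
  coboundary phi -> coboundary (fun s => - phi s).
Proof.
move=> phi_cob; have := coboundaryB (@coboundary0 R X n) phi_cob.
by congr coboundary; apply/funext => s; rewrite sub0r.
Qed.

Lemma coboundaryD n (phi psi : cochain R X n) :
  coboundary phi -> coboundary psi -> coboundary (fun s => phi s + psi s).
Proof.
move=> phi_cob /coboundaryN psi_cob; have := coboundaryB phi_cob psi_cob.
by congr coboundary; apply/funext => s; rewrite opprK.
Qed.

Lemma coboundary_sum n (J : finType) (phi : J -> cochain R X n) :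
  (forall j, coboundary (phi j)) -> coboundary (fun s => \sum_j phi j s).
Proof.
move=> phi_cob; pose P (f : cochain R X n) := coboundary f.
have -> : (fun s => \sum_j phi j s) = \sum_j phi j.
  by apply/funext => s; rewrite fct_sumE.
apply: (big_ind P) => [|f g|j _]; first exact: coboundary0.
  exact: coboundaryD.
exact: phi_cob.
Qed.

Lemma coboundaryZ n (c : rat) (phi : cochain R X n) :
  coboundary phi -> coboundary (fun s => c * phi s).
Proof.
case: n phi => [|n] phi /=; first by move=> ->; apply/funext => s; rewrite mulr0.
move=> [psi _ <-]; exists (fun s => c * psi s) => //; apply/funext => s.
rewrite !coboundary_mapE mulr_sumr; apply: eq_bigr => i _.
by rewrite mulrCA.
Qed.

Lemma coboundary_pullback (Y : topologicalType) (f : Y -> X) (fc : continuous f) n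
    (phi : cochain R X n) :
  coboundary phi -> coboundary (fun s => phi (map_simplex fc s)).
Proof.
case: n phi => [|n] phi /=; first by move=> ->.
move=> [psi _ <-]; exists (fun s => psi (map_simplex fc s)) => //.
apply/funext => s; apply: eq_bigr => i _; congr (_ * psi _).
exact: simplexP.
Qed.

Lemma cocycle_pullback (Y : topologicalType) (f : Y -> X) (fc : continuous f) n
    (phi : cochain R X n) :
  cocycle phi -> cocycle (fun s => phi (map_simplex fc s)).
Proof.
move=> phi0 s; rewrite -[RHS](phi0 (map_simplex fc s)).
apply: eq_bigr => i _; congr (_ * phi _); exact: simplexP.
Qed.

End CochainAlgebra.

Lemma face_borel_simplex (R : realType) (H : topologicalGroupType)
    (P : principal_bundle H) (X : topologicalType) (a : left_action H X) n
    (i : 'I_n.+2) (s : singular_simplex R (total_space P) n.+1)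
    (x : singular_simplex R X n.+1) :
  face i (borel_simplex a s x) = borel_simplex a (face i s) (face i x).
Proof. exact: simplexP. Qed.

(** Restates formality with cochains, so that both directions can construct one explicit cocycle on
    the Borel construction. *)
Lemma equivariantly_formalP (R : realType) (H : topologicalGroupType)
    (EH : universal_bundle R H) (X : topologicalType) (a : left_action H X) :
  equivariantly_formal EH a <->
  forall (e : total_space EH) n (zeta : cochain R X n), cocycle zeta ->
    exists gamma : cochain R (homotopy_quotient EH a) n, cocycle gamma /\
      coboundary (fun s => gamma (borel_simplex a (const_simplex R n e) s) - zeta s).
Proof.
have fibE (e : total_space EH) n (s : singular_simplex R X n) :
    (fiber_inclusion EH a e \o s : singular_simplex R (homotopy_quotient EH a) n) =
    borel_simplex a (const_simplex R n e) s.
  exact: simplexP.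
split=> [formal e n zeta zeta0|formal e n c _].
  pose z : @cocycle R X n := exist _ zeta (mem_set zeta0).
  have [g _ gz] := formal e n (cohomology_class z) I.
  exists (val (representative g)); split; first exact: (set_mem (valP _)).
  have /cohomology_classP := gz; rewrite /= /pullback.
  by congr coboundary; apply/funext => s; rewrite fibE.
pose z := representative c.
have [gamma [gamma0 gz]] := formal e n (val z) (set_mem (valP z)).
pose g : @cocycle R (homotopy_quotient EH a) n := exist _ gamma (mem_set gamma0).
exists (cohomology_class g) => //; rewrite cohomology_map_class.
rewrite -[RHS]representativeK; apply/cohomology_classP; rewrite /= /pullback.
by move: gz; congr coboundary; apply/funext => s; rewrite fibE.
Qed.

(** A labelling of the vertices of the i-th facet has #|V| extensions to the whole simplex. This
    compares averages on a simplex with averages on its faces. *)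
Lemma ffun_sum_lift (V : finType) n (i : 'I_n.+2) (F : {ffun 'I_n.+1 -> V} -> rat) :
  \sum_(v : {ffun 'I_n.+2 -> V}) F [ffun l => v (lift i l)] =
  #|V|%:R * \sum_(v : {ffun 'I_n.+1 -> V}) F v.
Proof.
rewrite (partition_big (fun v : {ffun 'I_n.+2 -> V} => [ffun l => v (lift i l)]) xpredT)//.
rewrite mulr_sumr; apply: eq_bigr => u _.
rewrite (eq_bigr (fun=> F u)); last by move=> v /eqP ->.
rewrite sumr_const -[LHS]mulr_natl; congr (_%:R * _).
pose ext (x : V) : {ffun 'I_n.+2 -> V} :=
  [ffun l => if unlift i l is Some k then u k else x].
rewrite -(card_codom (_ : injective ext)); last first.
  by move=> x y /ffunP/(_ i); rewrite !ffunE unlift_none.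
apply: eq_card => v; rewrite -[LHS]/([ffun l => v (lift i l)] == u).
apply/eqP/codomP => [uE|[x ->]].
  exists (v i); apply/ffunP => l; rewrite ffunE; case: unliftP => [k ->|-> //].
  by rewrite -uE ffunE.
by apply/ffunP => l; rewrite !ffunE liftK.
Qed.

(** * The covering of the isotropy action *)

Section IsotropyCovering.
Context (R : realType) (G Gt : topologicalGroupType) (K : subgroup G).
Context (p : UMagmaMorphism.type Gt G).
Context (G_hausdorff : hausdorff_space G) (G_compact : compact [set: G]).
Context (K_closed : closed (subgroup_set K)) (K_connected : connected (subgroup_set K)).
Context (p_covering : finite_central_covering R p).

Local Notation H := (identity_component (preimage_subgroup p K)).
Local Notation X := (coset_space K).
Local Notation Xt := (coset_space H).
Local Notation Sing := (singular_simplex R).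

Let pM x y : p (x * y)%g = (p x * p y)%g. Proof. exact: gmulfM. Qed.
Let pV x : p (x^-1)%g = ((p x)^-1)%g. Proof. exact: gmulfV. Qed.

Lemma identity_component_image x : subgroup_set H x -> subgroup_set K (p x).
Proof. exact: connected_component_sub. Qed.

Definition covering_restrict (h : set_type H) : set_type K :=
  exist _ (p (val h)) (mem_set (identity_component_image (set_mem (valP h)))).
Local Notation phi := covering_restrict.

Lemma covering_restrictM g h : phi (g * h)%g = (phi g * phi h)%g.
Proof. by apply: val_inj; rewrite /= !gmulfM. Qed.

Lemma covering_restrict1 : phi 1%g = 1%g.
Proof. by apply: val_inj; rewrite /= !gmulf1. Qed.

Lemma covering_restrictV h : phi (h^-1)%g = ((phi h)^-1)%g.
Proof. by apply: val_inj; rewrite /= !gmulfV. Qed.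

Lemma covering_restrict_continuous : continuous phi.
Proof.
apply: set_type_continuous => h.
apply: (@continuous_comp _ _ _ (fun h : set_type H => val h) p).
  exact: val_continuous.
exact: (covering_continuous p_covering).
Qed.

Let H_relclopen := identity_component_relclopen p_covering G_hausdorff G_compact K_connected.

Lemma covering_restrict_surj k : exists h, phi h = k.
Proof.
have [_ _ HK] := H_relclopen.
have : (p @` subgroup_set H) (val k) by rewrite HK; exact: (set_mem (valP k)).
by move=> [x Hx xk]; exists (exist _ x (mem_set Hx)); apply: val_inj.
Qed.

(** An open map need not stay open on a subgroup; here it does because H is relatively open in the
    preimage of K. *)
Lemma covering_restrict_open U : open U -> open (phi @` U).
Proof.
have [[W oW HW] _ _] := H_relclopen.
move=> [V oV <-]; exists (p @` (V `&` W)).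
  by apply: (covering_open p_covering G_hausdorff G_compact); exact: openI.
apply/seteqP; split=> [k [x [Vx Wx] xk]|_ [h Vh <-]].
  have Hx : subgroup_set H x.
    have : (subgroup_set (preimage_subgroup p K) `&` W) x.
      by split=> //; rewrite /= /preimage /= xk; exact: (set_mem (valP k)).
    by rewrite -HW.
  by exists (exist _ x (mem_set Hx)) => //; apply: val_inj.
exists (val h) => //; split=> //.
have [] : (subgroup_set (preimage_subgroup p K) `&` W) (val h) by
  rewrite -HW; exact: (set_mem (valP h)).
by [].
Qed.

Lemma identity_component_closed : closed (subgroup_set H).
Proof.
have [_ [D cD ->] _] := H_relclopen; apply: closedI => //.
apply: closed_comp => // x _; exact: (covering_continuous p_covering).
Qed.

Definition coset_cover (c : Xt) : X := coset_pi K (p (repr c)).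

Lemma coset_cover_pi x : coset_cover (coset_pi H x) = coset_pi K (p x).
Proof.
apply/coset_piP; rewrite -pV -pM; apply: identity_component_image.
by apply/coset_piP; exact: coset_piK.
Qed.

Lemma coset_cover_continuous : continuous coset_cover.
Proof.
apply/quotient_continuous.
rewrite (_ : _ \o _ = @coset_pi G K \o p); last first.
  by apply/funext => x; exact: coset_cover_pi.
move=> x; apply: continuous_comp; first exact: (covering_continuous p_covering).
exact: coset_pi_continuous.
Qed.

Lemma coset_cover_surj c : exists c', coset_cover c' = c.
Proof.
have [x _ xE] := @covering_surjective _ _ _ _ p_covering (repr c) I.
by exists (coset_pi H x); rewrite coset_cover_pi xE coset_piK.
Qed.

Lemma coset_cover_open U : open U -> open (coset_cover @` U).
Proof.
move=> oU; rewrite (_ : _ @` U = @coset_pi G K @` (p @` (@coset_pi Gt H @^-1` U))).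
  apply: coset_pi_open; apply: (covering_open p_covering G_hausdorff G_compact).
  exact: oU.
apply/seteqP; split=> [_ [c Uc <-]|_ [_ [x Ux <-] <-]].
  exists (p (repr c)) => //; exists (repr c) => //.
  by rewrite /preimage /= coset_piK.
by exists (coset_pi H x) => //; rewrite coset_cover_pi.
Qed.

Lemma coset_cover_isotropy h c :
  coset_cover (isotropy_map h c) = isotropy_map (phi h) (coset_cover c).
Proof.
by rewrite -(coset_piK c) isotropy_map_pi !coset_cover_pi isotropy_map_pi pM.
Qed.

Lemma coset_cover_mul z c : p z = 1%g -> coset_cover (coset_mul z c) = coset_cover c.
Proof.
by move=> pz; rewrite -(coset_piK c) coset_mul_pi !coset_cover_pi pM pz mul1g.
Qed.

Lemma ker_central z x : p z = 1%g -> (z * x = x * z)%g.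
Proof. by move=> pz; exact: (covering_central_kernel p_covering). Qed.

(** As H surjects onto K, the element x^-1 * y is z * h with z in the kernel and h in H; centrality
    then turns y = x * z * h into z * x * h. *)
Lemma coset_cover_fiber c c' : coset_cover c = coset_cover c' ->
  exists z, p z = 1%g /\ c' = coset_mul z c.
Proof.
rewrite -(coset_piK c) -(coset_piK c'); move: (repr c) (repr c') => x y.
rewrite !coset_cover_pi => /coset_piP; rewrite -pV -pM => Kxy.
pose k : set_type K := exist _ (p (x^-1 * y)%g) (mem_set Kxy).
have [h hE] := covering_restrict_surj k.
have ph : p (val h) = p (x^-1 * y)%g by have := congr1 val hE.
have [z [pz xyE]] := covering_ker ph; exists z; split=> //.
rewrite coset_mul_pi; apply/esym/coset_piP.
rewrite (ker_central x pz) invgM -mulgA xyE mulKg.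
exact: (set_mem (valP h)).
Qed.

(** By centrality the condition does not involve the coset c, so a kernel element fixing one coset
    fixes all of them. *)
Lemma coset_mul_ker_fix z (c : Xt) : p z = 1%g ->
  (coset_mul z c = c <-> subgroup_set H z).
Proof.
move=> pz; rewrite -(coset_piK c) coset_mul_pi; move: (repr c) => x.
rewrite (ker_central x pz); split=> [/esym/coset_piP|Hz]; first by rewrite mulKg.
by apply/esym/coset_piP; rewrite mulKg.
Qed.

Lemma isotropy_coset_mul z h c : p z = 1%g ->
  coset_mul z (isotropy_map h c) = isotropy_map h (coset_mul z c) :> Xt.
Proof.
move=> pz; rewrite -(coset_piK c) isotropy_map_pi !coset_mul_pi isotropy_map_pi.
by rewrite !mulgA (ker_central _ pz).
Qed.

Context (J : finType) (v : J -> Gt) (v_inj : injective v).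
Hypothesis vP : forall z, p z = 1%g <-> exists j, v j = z.
Context (N : finType) (w : N -> set_type H) (w_inj : injective w).
Hypothesis wP : forall h, phi h = 1%g <-> exists j, w j = h.

Let pv j : p (v j) = 1%g. Proof. by apply/vP; exists j. Qed.
Let phiw j : phi (w j) = 1%g. Proof. by apply/wP; exists j. Qed.

Let Gt_hausdorff : hausdorff_space Gt.
Proof. by have [] := covering_Lie_group p_covering. Qed.

Let Xt_hausdorff : hausdorff_space Xt.
Proof. exact/coset_space_hausdorff/identity_component_closed. Qed.

Let H_hausdorff : hausdorff_space (set_type H).
Proof.
rewrite open_hausdorff => g h gh.
have vgh : val g != val h by apply: contra gh => /eqP/val_inj ->.
move: Gt_hausdorff; rewrite open_hausdorff => /(_ _ _ vgh)[[A C] /= [/set_mem Ag /set_mem Ch]].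
move=> [oA oC /eqP AC].
exists (val @^-1` A, val @^-1` C) => /=; first by split; apply/mem_set.
split; [by exists A|by exists C|].
by rewrite -preimage_setI AC preimage_set0.
Qed.

Let q_fiber c c' : coset_cover c = coset_cover c' -> exists j, c' = coset_mul (v j) c.
Proof.
move=> /coset_cover_fiber[z [pz ->]]; have [j <-] := (vP z).1 pz.
by exists j.
Qed.

Let q_semifree j (c c' : Xt) : coset_mul (v j) c = c -> coset_mul (v j) c' = c'.
Proof.
move=> /(coset_mul_ker_fix c (pv j)) Hz.
exact/(coset_mul_ker_fix c' (pv j)).
Qed.

(** * The transfer for the covering of coset spaces *)

Definition deck n j (x : Sing Xt n) : Sing Xt n :=
  map_simplex (@coset_mul_continuous Gt H (v j)) x.

Definition cover_simplex n (x : Sing Xt n) : Sing X n :=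
  map_simplex coset_cover_continuous x.

Lemma cover_simplex_lift n (x : Sing X n) : exists x', cover_simplex x' = x.
Proof.
have [x' xP] := finite_cover_simplex_lift Xt_hausdorff coset_cover_open
  coset_cover_surj (fun j => @coset_mul_continuous Gt H (v j))
  (fun j c => coset_cover_mul c (pv j)) q_fiber q_semifree x.
by exists x'; exact: simplexP.
Qed.

Lemma cover_simplex_deck n (x x' : Sing Xt n) : cover_simplex x = cover_simplex x' ->
  exists j, x' = deck j x.
Proof.
move=> xx'; have [t|j jE] := finite_cover_simplex_act Xt_hausdorff
  (fun j => @coset_mul_continuous Gt H (v j))
  (fun j c => coset_cover_mul c (pv j)) q_fiber q_semifree (s := x) (s' := x').
  exact: (congr1 (fun f : Sing X n => f t) xx').
by exists j; exact: simplexP.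
Qed.

Lemma deck_cover n j (x : Sing Xt n) : cover_simplex (deck j x) = cover_simplex x.
Proof. by apply: simplexP => t; exact: coset_cover_mul. Qed.

Lemma deck_comp k : exists f : J -> J, bijective f /\
  forall j n (x : Sing Xt n), deck j (deck k x) = deck (f j) x.
Proof.
have /choice[f fP] j : exists l, v l = (v j * v k)%g.
  by apply/vP; rewrite pM !pv mulg1.
exists f; split.
  by apply: injF_bij => i j /(congr1 v); rewrite !fP => /mulIg/v_inj.
move=> j n x; apply: simplexP => t /=.
by rewrite -(coset_piK (x t)) !coset_mul_pi fP mulgA.
Qed.

Lemma deck_sum n (F : Sing Xt n -> rat) k (x : Sing Xt n) :
  \sum_j F (deck j (deck k x)) = \sum_j F (deck j x).
Proof.
have [f [fbij fP]] := deck_comp k.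
rewrite [RHS](reindex f)/=; last exact: onW_bij.
by apply: eq_bigr => j _; rewrite fP.
Qed.

Definition lift_simplex n (x : Sing X n) : Sing Xt n :=
  projT1 (cid (cover_simplex_lift x)).

Lemma lift_simplexK n (x : Sing X n) : cover_simplex (lift_simplex x) = x.
Proof. exact: projT2 (cid (cover_simplex_lift x)). Qed.

(** The average runs over the whole kernel and not over the sheets: each sheet is counted once for
    every kernel element lying in H, and [#|J|] accounts for this. *)
Definition transfer n (zeta : cochain R Xt n) : cochain R X n :=
  fun x => #|J|%:R^-1 * \sum_j zeta (deck j (lift_simplex x)).

Lemma transferE n (zeta : cochain R Xt n) (x : Sing Xt n) :
  transfer zeta (cover_simplex x) = #|J|%:R^-1 * \sum_j zeta (deck j x).
Proof.
rewrite /transfer; have := lift_simplexK (cover_simplex x).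
by move=> /esym/cover_simplex_deck[k ->]; rewrite deck_sum.
Qed.

Lemma face_cover_simplex n i (x : Sing Xt n.+1) :
  face i (cover_simplex x) = cover_simplex (face i x).
Proof. exact: simplexP. Qed.

Lemma face_deck n i j (x : Sing Xt n.+1) : face i (deck j x) = deck j (face i x).
Proof. exact: simplexP. Qed.

Lemma coboundary_map_transfer n (zeta : cochain R Xt n) :
  coboundary_map (transfer zeta) = transfer (coboundary_map zeta).
Proof.
apply/funext => x; rewrite -(lift_simplexK x) transferE coboundary_mapE.
under eq_bigr do rewrite face_cover_simplex transferE mulrCA mulr_sumr.
rewrite -mulr_sumr exchange_big; congr (_ * _); apply: eq_bigr => j _.
by rewrite coboundary_mapE; apply: eq_bigr => i _; rewrite face_deck.
Qed.

Lemma transfer_cocycle n (zeta : cochain R Xt n) : cocycle zeta -> cocycle (transfer zeta).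
Proof. by move=> zeta0 x; rewrite coboundary_map_transfer /transfer big1 ?mulr0. Qed.

Lemma transfer_coboundary n (zeta : cochain R Xt n) :
  coboundary zeta -> coboundary (transfer zeta).
Proof.
case: n zeta => [|n] zeta /=.
  by move=> ->; apply/funext => x; rewrite /transfer big1 ?mulr0.
move=> [psi _ <-]; exists (transfer psi) => //.
exact: coboundary_map_transfer.
Qed.

Lemma cardJ_neq0 : #|J|%:R != 0 :> rat.
Proof.
have p1 : p 1%g = 1%g by exact: gmulf1.
have [j _] := (vP 1%g).1 p1.
by rewrite pnatr_eq0 -lt0n; apply/card_gt0P; exists j.
Qed.

Lemma cardN_neq0 : #|N|%:R != 0 :> rat.
Proof.
have [j _] := (wP 1%g).1 covering_restrict1.
by rewrite pnatr_eq0 -lt0n; apply/card_gt0P; exists j.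
Qed.

(* The deck group acts trivially on cohomology, because it is contained in the
   path-connected group Gt, which acts on Xt. *)
Lemma pullback_transfer n (zeta : cochain R Xt n) : cocycle zeta ->
  coboundary (fun x => transfer zeta (cover_simplex x) - zeta x).
Proof.
move=> zeta0.
have -> : (fun x => transfer zeta (cover_simplex x) - zeta x) =
    (fun x => #|J|%:R^-1 * \sum_j (zeta (deck j x) - zeta x)).
  apply/funext => x; rewrite transferE sumrB sumr_const mulrBr.
  by rewrite -[zeta x *+ _]mulr_natl mulKf ?cardJ_neq0.
apply: coboundaryZ; apply: coboundary_sum => j.
apply: coset_mul_cohomologous => //; first exact: covering_Lie_group p_covering.
exact: covering_connected p_covering.
Qed.

Lemma transfer_pullback n (zeta : cochain R X n) x :
  transfer (fun x => zeta (cover_simplex x)) x = zeta x.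
Proof.
rewrite -(lift_simplexK x) transferE.
under eq_bigr do rewrite deck_cover.
by rewrite sumr_const -[zeta _ *+ _]mulr_natl mulKf ?cardJ_neq0.
Qed.

Section SimplexAction.
Context (S : topologicalGroupType) (P : principal_bundle S) (Y : topologicalType).
Context (a : left_action S Y) (n : nat).

Lemma simplex_lact_continuous (h : Sing S n) (x : Sing Y n) :
  continuous (fun t => a (h t) (x t)).
Proof. by move=> t; apply: left_action_continuous; exact: cts_fun. Qed.

Definition simplex_lact (h : Sing S n) (x : Sing Y n) : Sing Y n :=
  to_simplex (@simplex_lact_continuous h x).

Lemma borel_simplex_act (s : Sing (total_space P) n) h x :
  borel_simplex a (simplex_act (@ract_continuous _ P) s h) x =
  borel_simplex a s (simplex_lact h x).
Proof. by apply: simplexP => t; exact: borel_pi_act. Qed.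

Lemma borel_simplex_eqP (s s' : Sing (total_space P) n) x x' :
  borel_simplex a s x = borel_simplex a s' x' ->
  exists h, s = simplex_act (@ract_continuous _ P) s' h /\ x' = simplex_lact h x.
Proof.
by move=> /borel_simplex_eq[h [-> xE]]; exists h; split=> //; exact: simplexP.
Qed.

End SimplexAction.

(** * The two implications *)

Context (EK : universal_bundle R (set_type K)).
Context (EH : universal_bundle R (set_type H)).
Local Notation aK := (isotropy_action K).
Local Notation aH := (isotropy_action H).

Definition map_covering n (h : Sing (set_type H) n) : Sing (set_type K) n :=
  map_simplex covering_restrict_continuous h.

Lemma cover_simplex_lact n (h : Sing (set_type H) n) (x : Sing Xt n) :
  cover_simplex (simplex_lact aH h x) = simplex_lact aK (map_covering h) (cover_simplex x).
Proof. by apply: simplexP => t; exact: coset_cover_isotropy. Qed.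

Lemma deck_lact n j (h : Sing (set_type H) n) (x : Sing Xt n) :
  deck j (simplex_lact aH h x) = simplex_lact aH h (deck j x).
Proof. by apply: simplexP => t; exact: isotropy_coset_mul. Qed.

Lemma isotropy_formal_covering : isotropy_formal K EK -> isotropy_formal H EH.
Proof.
move=> /equivariantly_formalP formalK; apply/equivariantly_formalP => et n zeta zeta0.
have [e _] := universal_contractible EK.
(* EK becomes an H-space through [phi]. This action need not be free, but the target of
   [equivariant_extension] is only required to be contractible. *)
pose rho (x : total_space EK) (h : set_type H) := ract x (phi h).
have rhoc : continuous (fun z : total_space EK * set_type H => rho z.1 z.2).
  move=> z; apply: (@continuous_comp2 _ _ _ _ fst (fun z => phi z.2)
    (fun z => ract z.1 z.2)).
  - exact: cvg_fst.
  - apply: (@continuous_comp _ _ _ snd phi); first exact: cvg_snd.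
    exact: covering_restrict_continuous.
  - exact: ract_continuous.
have [f [fd fM fb]] := @equivariant_extension R (set_type H)
  (fun m => Sing (total_space EH) m) (fun m i s => face i s)
  (fun m s h => simplex_act (@ract_continuous _ EH) s h)
  (fun m => const_simplex R m et)
  (fun m i j i' j' s ij ji => face_face s ij ji)
  ltac:(by move=> m i s h; exact: simplexP)
  ltac:(by move=> m s; apply: simplexP => t; exact: ract1)
  ltac:(by move=> m s g h; apply: simplexP => t; rewrite /= ractM)
  ltac:(by move=> m s g h gh; apply: simplexP => t;
    apply: (@ract_inj _ _ (s t)); exact: (congr1 (fun u : Sing _ m => u t) gh))
  ltac:(by move=> m i; exact: simplexP)
  (total_space EK) (universal_contractible EK) e rho rhoc
  ltac:(by move=> x; rewrite /rho covering_restrict1 ract1)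
  ltac:(by move=> x g h; rewrite /rho covering_restrictM ractM).
have [gamma [gamma0 gb]] := formalK e n _ (transfer_cocycle zeta0).
have lift_ex (tau : Sing (homotopy_quotient EH aH) n) :
  exists z : Sing (total_space EH) n * Sing Xt n, tau = borel_simplex aH z.1 z.2.
  by have [s [x ->]] := borel_simplex_lift tau; exists (s, x).
pose lft tau := projT1 (cid (lift_ex tau)).
pose gamma' (tau : Sing (homotopy_quotient EH aH) n) :=
  gamma (borel_simplex aK (f n (lft tau).1) (cover_simplex (lft tau).2)).
have gammaE s x : gamma' (borel_simplex aH s x) =
    gamma (borel_simplex aK (f n s) (cover_simplex x)).
  have := projT2 (cid (lift_ex (borel_simplex aH s x))).
  rewrite -/(lft _) /gamma'; move: (lft _) => [s' x'] /= /esym/borel_simplex_eqP[h [-> ->]].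
  rewrite fM cover_simplex_lact -borel_simplex_act.
  by congr gamma; congr borel_simplex; exact: simplexP.
exists gamma'; split=> [tau|].
  have [s [x ->]] := borel_simplex_lift tau.
  rewrite -[RHS](gamma0 (borel_simplex aK (f n.+1 s) (cover_simplex x))).
  apply: eq_bigr => i _; congr (_ * _).
  transitivity (gamma' (borel_simplex aH (face i s) (face i x))).
    by congr gamma'; exact: simplexP.
  by rewrite gammaE fd; congr gamma; exact: simplexP.
(* Since f fixes the base point, the restriction to the fibre is the pullback of that of [gamma],
   hence cohomologous to the pulled back transfer of [zeta], hence to [zeta]. *)
have := coboundaryD (coboundary_pullback coset_cover_continuous gb) (pullback_transfer zeta0).
congr coboundary; apply/funext => s.
by rewrite gammaE fb addrA subrK.
Qed.

Let w_fiber (g h : set_type H) : phi g = phi h -> exists j, h = (w j * g)%g.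
Proof.
move=> gh; have /wP[j jE] : phi (h * g^-1)%g = 1%g.
  by rewrite covering_restrictM covering_restrictV gh mulgV.
by exists j; rewrite jE mulgVK.
Qed.

Let phi_w j h : phi (w j * h)%g = phi h.
Proof. by rewrite covering_restrictM phiw mul1g. Qed.

Let w_semifree j (g h : set_type H) : (w j * g)%g = g -> (w j * h)%g = h.
Proof. by move=> /(congr1 (fun x => x * g^-1)%g); rewrite mulgK mulgV => ->; rewrite mul1g. Qed.

Lemma map_covering_lift n (k : Sing (set_type K) n) : exists h, map_covering h = k.
Proof.
have [h hP] := finite_cover_simplex_lift H_hausdorff covering_restrict_open
  covering_restrict_surj (fun j => @lmulg_continuous (set_type H) (w j))
  phi_w w_fiber w_semifree k.
by exists h; exact: simplexP.
Qed.

Lemma map_covering_inj n (g h : Sing (set_type H) n) t :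
  map_covering g = map_covering h -> g t = h t -> g = h.
Proof.
move=> gh; apply: (finite_cover_simplex_eq H_hausdorff
  (fun j => @lmulg_continuous (set_type H) (w j)) w_fiber w_semifree) => u.
exact: (congr1 (fun f : Sing (set_type K) n => f u) gh).
Qed.

Lemma isotropy_formal_descent : isotropy_formal H EH -> isotropy_formal K EK.
Proof.
move=> /equivariantly_formalP formalH; apply/equivariantly_formalP => e n zeta zeta0.
have [et _] := universal_contractible EH.
have [gamma [gamma0 gb]] :=
  formalH et n _ (cocycle_pullback coset_cover_continuous zeta0).
have [kappa [kM _]] := @orbit_coordinate (total_space EK) (set_type K) 1%g
  (fun g h => g * h)%g (fun g => g^-1)%g (@ract _ EK) e (@ract1 _ EK)
  (fun x g h => esym (ractM x g h)) (@mulgV _) (@ract_inj _ EK).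
have /choice[eta etaP] x : exists h, phi h = kappa x := covering_restrict_surj _.
(* H acts on Sing(EK) through [phi], not freely. A simplex of H is determined by its image in K and
   its value at one vertex, so one label would already give freeness; a label at every vertex makes
   the object stable under faces. *)
pose S m := (Sing (total_space EK) m * ('I_m.+1 -> set_type H))%type.
pose d m (i : 'I_m.+2) (s : S m.+1) : S m := (face i s.1, s.2 \o lift i).
pose act m (s : S m) (h : Sing (set_type H) m) : S m :=
  (simplex_act (@ract_continuous _ EK) s.1 (map_covering h),
   fun i => (s.2 i * h (vertex R i))%g).
pose b m : S m := (const_simplex R m e, fun=> eta e).
have d_d m (i j : 'I_m.+3) (i' j' : 'I_m.+2) (s : S m.+2) :
    lift i j' = j -> lift j i' = i -> d m j' (d m.+1 i s) = d m i' (d m.+1 j s).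
  move=> ij ji; rewrite /d /= (face_face _ ij ji); congr pair.
  by apply/funext => k /=; rewrite (lift_swap k ij ji).
have d_act m (i : 'I_m.+2) (s : S m.+1) h :
    d m i (act m.+1 s h) = act m (d m i s) (face i h).
  rewrite /d /act /=; congr pair; first exact: simplexP.
  by apply/funext => k /=; rewrite face_map_vertex.
have act1 m (s : S m) : act m s (simplex_one R (set_type H) m) = s.
  case: s => s u; rewrite /act; congr pair.
    by apply: simplexP => t; rewrite /= covering_restrict1 ract1.
  by apply/funext => k /=; rewrite mulg1.
have actM m (s : S m) g h : act m (act m s g) h = act m s (simplex_mul g h).
  rewrite /act /=; congr pair.
    by apply: simplexP => t; rewrite /= covering_restrictM ractM.
  by apply/funext => k /=; rewrite mulgA.
have act_free m (s : S m) g h : act m s g = act m s h -> g = h.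
  move=> [gh1 gh2]; apply: (@map_covering_inj _ _ _ (vertex R (ord0 : 'I_m.+1))).
    apply: simplexP => t; apply: (@ract_inj _ _ (s.1 t)).
    exact: (congr1 (fun u => u t) gh1).
  by have := congr1 (fun u => u ord0) gh2 => /mulgI.
have d_b m (i : 'I_m.+2) : d m i (b m.+1) = b m.
  by rewrite /d /b /=; congr pair; exact: simplexP.
have [f [fd fM fb]] := @equivariant_extension R (set_type H) S d act b
  d_d d_act act1 actM act_free d_b (total_space EH) (universal_contractible EH) et
  (@ract _ EH) (@ract_continuous _ EH) (@ract1 _ EH) (@ractM _ EH).
(* The vertices of a simplex of EK are lifted from K-coordinates to
   H-coordinates, and the first k of the lifts are averaged over the kernel. *)
pose mix m k (s : Sing (total_space EK) m) (u : {ffun 'I_m.+1 -> N}) (i : 'I_m.+1) :=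
  ((if (i < k)%N then w (u i) else 1) * eta (s (vertex R i)))%g.
(* u labels all vertices although only the first k labels are read, so the number of terms does not
   depend on k. *)
pose Psi k (s : Sing (total_space EK) n) (x : Sing Xt n) : rat :=
  \sum_(u : {ffun 'I_n.+1 -> N}) \sum_j
    gamma (borel_simplex aH (f n (s, mix n k s u)) (deck j x)).
have Psi_deck k s j x : Psi k s (deck j x) = Psi k s x.
  apply: eq_bigr => u _.
  exact: (deck_sum (fun y => gamma (borel_simplex aH (f n (s, mix n k s u)) y))).
have Psi_face k (s : Sing (total_space EK) n.+1) (x : Sing Xt n.+1) :
    \sum_(i < n.+2) (-1) ^+ i * Psi (k - (i < k))%N (face i s) (face i x) = 0.
  (* The factor [#|N|] turns labellings of each face into labellings of the whole simplex. Then k -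
     (i < k) is the number of moved vertices left on face i, and the cocycle condition of [gamma]
     applies term by term. *)
  apply: (mulfI cardN_neq0); rewrite mulr0 mulr_sumr.
  transitivity (\sum_(i < n.+2) \sum_(u : {ffun 'I_n.+2 -> N}) \sum_j (-1) ^+ i *
      gamma (face i (borel_simplex aH (f n.+1 (s, mix n.+1 k s u)) (deck j x)))).
    apply: eq_bigr => i _; rewrite mulrCA -(ffun_sum_lift i) mulr_sumr.
    apply: eq_bigr => u _; rewrite mulr_sumr; apply: eq_bigr => j _.
    congr (_ * gamma _); rewrite face_borel_simplex -fd; congr borel_simplex.
      congr (f n _); rewrite /d /=; congr pair; apply/funext => l.
      have lk : (l < k - (i < k))%N = (lift i l < k)%N.
        by rewrite /= /bump; case: (leqP i l); case: (ltnP i k) => ? ? /=; lia.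
      by rewrite /mix lk /= ffunE face_map_vertex.
    exact: simplexP.
  rewrite exchange_big big1// => u _; rewrite exchange_big big1// => j _.
  exact: gamma0.
have Psi_act k s h x : map_covering h = k ->
    Psi n.+1 (simplex_act (@ract_continuous _ EK) s k) x =
    Psi n.+1 s (simplex_lact aH h x).
  move=> hk; set s' := simplex_act _ s k.
  (* At each vertex [eta] is equivariant up to an element of N. With all labels averaged, this error
     is absorbed by permuting the labellings; hence k = n.+1 in the claim. *)
  have /choice[mu muP] (i : 'I_n.+1) : exists j,
      eta (s' (vertex R i)) = (w j * (eta (s (vertex R i)) * h (vertex R i)))%g.
    apply: w_fiber; rewrite covering_restrictM !etaP kM -hk.
    by [].
  have /choice[g gP] (ij : 'I_n.+1 * N) : exists l, w l = (w ij.2 * w (mu ij.1))%g.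
    by apply/wP; rewrite covering_restrictM !phiw mulg1.
  pose Gf (u : {ffun 'I_n.+1 -> N}) := [ffun i => g (i, u i)].
  have Gbij : bijective Gf.
    apply: injF_bij => u u' uu'; apply/ffunP => i.
    have := congr1 w (congr1 (fun u : {ffun 'I_n.+1 -> N} => u i) uu').
    by rewrite !ffunE !gP => E; apply: w_inj; exact: mulIg E.
  rewrite [RHS](reindex Gf)/=; last exact: onW_bij.
  apply: eq_bigr => u _; apply: eq_bigr => j _; rewrite deck_lact -borel_simplex_act.
  congr gamma; congr borel_simplex; rewrite -fM; congr (f n _).
  rewrite /act hk; congr pair; apply/funext => i.
  by rewrite /mix /= ltn_ord ffunE gP /= muP !mulgA.
pose C : rat := (#|{ffun 'I_n.+1 -> N}|%:R)^-1 * #|J|%:R^-1.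
have lift_ex (tau : Sing (homotopy_quotient EK aK) n) :
  exists z : Sing (total_space EK) n * Sing X n, tau = borel_simplex aK z.1 z.2.
  by have [s [x ->]] := borel_simplex_lift tau; exists (s, x).
pose lft tau := projT1 (cid (lift_ex tau)).
pose gamma' (tau : Sing (homotopy_quotient EK aK) n) :=
  C * Psi n.+1 (lft tau).1 (lift_simplex (lft tau).2).
have gammaE s x : gamma' (borel_simplex aK s (cover_simplex x)) = C * Psi n.+1 s x.
  have := projT2 (cid (lift_ex (borel_simplex aK s (cover_simplex x)))).
  rewrite -/(lft _) /gamma'; move: (lft _) => [s' x'] /= /esym/borel_simplex_eqP[k [-> xE]].
  have [h hk] := map_covering_lift k; rewrite (Psi_act _ _ _ _ hk).
  have : cover_simplex (simplex_lact aH h (lift_simplex x')) = cover_simplex x.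
    by rewrite cover_simplex_lact hk lift_simplexK xE.
  by move=> /cover_simplex_deck[j ->]; rewrite Psi_deck.
exists gamma'; split=> [tau|].
  have [s [x' ->]] := borel_simplex_lift tau; rewrite -(lift_simplexK x').
  move: (lift_simplex x') => x.
  rewrite -[RHS](mulr0 C) -(Psi_face n.+2 s x) mulr_sumr.
  apply: eq_bigr => i _; rewrite [RHS]mulrCA; congr (_ * _).
  transitivity (gamma' (borel_simplex aK (face i s) (cover_simplex (face i x)))).
    by congr gamma'; exact: simplexP.
  by rewrite gammaE ltn_ord subn1.
(* These interpolate on the fibre between the restriction of [gamma'], at k = n.+1, and the transfer
   of the restriction of [gamma], at k = 0. *)
pose psi k (x : Sing X n) := C * Psi k (const_simplex R n e) (lift_simplex x).
have psi_cob : coboundary (fun x => psi 0%N x - psi n.+1 x).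
  apply: prism => k x _; rewrite -[RHS](mulr0 C).
  rewrite -[in RHS](Psi_face k (const_simplex R n.+1 e) (lift_simplex x)) mulr_sumr.
  apply: eq_bigr => i _; rewrite /psi mulrCA; congr (_ * _); congr (_ * _).
  have : cover_simplex (face i (lift_simplex x)) =
      cover_simplex (lift_simplex (face i x)).
    by rewrite -face_cover_simplex !lift_simplexK.
  move=> /cover_simplex_deck[j ->]; rewrite Psi_deck.
  by congr (Psi _ _ _); exact: simplexP.
have psi0 x : psi 0%N x =
    transfer (fun y => gamma (borel_simplex aH (const_simplex R n et) y)) x.
  have -> : psi 0%N x = C * \sum_(u : {ffun 'I_n.+1 -> N}) \sum_j
      gamma (borel_simplex aH (const_simplex R n et) (deck j (lift_simplex x))).
    congr (_ * _); apply: eq_bigr => u _; apply: eq_bigr => j _.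
    (* With no label moved, the constant simplex at e carries [eta e] at every vertex: it is the
       base simplex, which f sends to the constant one at [et]. *)
    congr (gamma (borel_simplex _ _ _)); rewrite -fb; congr (f n _).
    by congr pair; apply/funext => i; rewrite /mix /= mul1g.
  rewrite sumr_const -mulr_natl /C mulrACA mulVf ?mul1r//.
  by rewrite card_ffun natrX expf_neq0//; exact: cardN_neq0.
have := coboundaryB (transfer_coboundary gb) psi_cob.
congr coboundary; apply/funext => x.
have gx : gamma' (borel_simplex aK (const_simplex R n e) x) = psi n.+1 x.
  by rewrite -[in LHS](lift_simplexK x) gammaE.
rewrite gx psi0 -(transfer_pullback zeta x) /transfer sumrB mulrBr.
by rewrite opprB addrC addrA subrK.
Qed.

End IsotropyCovering.

Theorem theorem1p2 (R : realType) (G Gt : topologicalGroupType) (K : subgroup G)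
    (p : UMagmaMorphism.type Gt G)
    (G_Lie : Lie_group R G) (G_compact : compact [set: G])
    (G_connected : connected [set: G])
    (K_closed : closed (subgroup_set K)) (K_connected : connected (subgroup_set K))
    (p_covering : finite_central_covering R p)
    (EK : universal_bundle R (set_type K))
    (EKt0 : universal_bundle R
      (set_type (identity_component (preimage_subgroup p K)))) :
  isotropy_formal K EK <->
  isotropy_formal (identity_component (preimage_subgroup p K)) EKt0.
Proof.
have [G_hausdorff _ _] := G_Lie.
have p_fin := covering_finite_kernel p_covering.
have [J [v [v_inj vP]]] := finite_set_enum p_fin.
have phi_fin : finite_set [set h | covering_restrict (p := p) (K := K) h = 1%g].
  rewrite (_ : [set h | _] = (fun h => val h) @^-1` (p @^-1` [set 1%g])).
    by apply: finite_preimage p_fin => g h _ _; exact: val_inj.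
  have val1 : val (1%g : set_type K) = 1%g by exact: gmulf1.
  apply/seteqP; split=> h; first by move=> /(congr1 val); rewrite val1.
  by move=> ph; apply: val_inj; rewrite val1.
have [N [w [w_inj wP]]] := finite_set_enum phi_fin.
split=> formal.
- exact: (isotropy_formal_covering G_hausdorff G_compact K_closed K_connected
    p_covering v_inj vP formal).
- exact: (isotropy_formal_descent G_hausdorff G_compact K_closed K_connected
    p_covering v_inj vP w_inj wP formal).
Qed.
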